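(* Let $\star\in\{\mathrm J,\mathrm L\}$ denote the Jacobi or the Laguerre I family of the context, with scalar step-line moment matrix $\mathscr M^\star=(\mathscr M^\star_{\alpha,\beta})_{\alpha,\beta\ge0}$, and define the shifted leading minors $$\Delta_{b,0}^\star=1,\qquad\Delta_{b,N}^\star=\det\bigl[\mathscr M^\star_{b+\alpha,\beta}\bigr]_{\alpha,\beta=0}^{N-1},\qquad b\in\{0,\dots,q\},\ N\ge1.$$ Assume that the minors which occur below are nonzero. Let $\tau_{b,N}^{\star,B}$ be the Christoffel tau-determinants and $U_b^\star$ the upper bidiagonal factors defined in the context. Then $$\tau_{b,N}^{\star,B}=(-1)^{bN}\frac{\Delta_{b,N}^\star}{\Delta_{0,N}^\star},\qquad b\in\{0,\dots,q\},\ N\in\mathbb N_0,$$ and consequently $$(U_b^\star)_{N,N}=\frac{\Delta_{b-1,N}^\star\,\Delta_{b,N+1}^\star}{\Delta_{b-1,N+1}^\star\,\Delta_{b,N}^\star},\qquad b\in\{1,\dots,q\},\ N\in\mathbb N_0.$$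
   Context: Weights. $\mathcal B_{a,b}(x)=x^a(1-x)^{b-a-1}/\Gamma(b-a)$ on $(0,1)$, $0$ elsewhere; $\mathcal G_a(x)=x^ae^{-x}$ on $(0,\infty)$; $(f*g)(x)=\int_0^\infty f(t)g(x/t)dt/t$; $\boldsymbol e_j$ coordinate vectors. Jacobi family ($\star=\mathrm J$): $p,q\ge1$, $-1<a_j<b_j$ ($j\le q$), exponents $\theta_i=\alpha_i$ with $\alpha_i+a_\rho>-1$; $w_0(x;\boldsymbol a,\boldsymbol b)=\mathcal B_{a_1,b_1}*\cdots*\mathcal B_{a_q,b_q}$; row weights $V_j=w_0(\cdot;\boldsymbol a,\boldsymbol b+\boldsymbol e_j)$, $1\le j\le q$, on $\Delta=(0,1)$. Laguerre I family ($\star=\mathrm L$): $q=r+s$, $r\ge0$, $s\ge1$, $\boldsymbol a\in(-1,\infty)^q$, $\boldsymbol b\in(-1,\infty)^r$, $a_h<b_h$ ($h\le r$), exponents $\theta_i=\beta_i$ with $\beta_i+a_\rho>-1$; $w_0=\mathcal B_{a_1,b_1}*\cdots*\mathcal B_{a_r,b_r}*\mathcal G_{a_{r+1}}*\cdots*\mathcal G_{a_q}$; row weights $V_h=w_0(\cdot;\boldsymbol a,\boldsymbol b+\boldsymbol e_h)$ for $h\le r$ and $V_{r+\ell}=(-x\frac d{dx})^{\ell-1}w_0$ for $1\le\ell\le s$, on $\Delta=(0,\infty)$. Moment matrix: $\mathscr M^\star$ has entry $\int_\Delta x^{u+v+\theta_i}V_j(x)dx$ in row $qu+j-1$ and column $pv+i-1$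 ($u,v\in\mathbb N_0$, $1\le j\le q$, $1\le i\le p$). Step-line forms. $\boldsymbol\sigma_d(N)\in\mathbb N_0^d$: if $N=dm+j$, $0\le j<d$, first $j$ entries $m+1$, the rest $m$. $\chi_N=(N\bmod q)+1$. The normalized step-line form is $\mathcal B_N^\star=\sum_{j=1}^q(\mathcal B_N^\star)^{(j)}V_j$, with polynomial components $(\mathcal B_N^\star)^{(j)}$ of degree at most $\boldsymbol\sigma_q(N+1)_j-1$, orthogonal to $x^{\theta_i+k}$ for $1\le i\le p$, $0\le k<\boldsymbol\sigma_p(N)_i$, and normalized so that the coefficient of $x^{\boldsymbol\sigma_q(N+1)_{\chi_N}-1}$ in $(\mathcal B_N^\star)^{(\chi_N)}$ is $1$. Tau-determinants: $\tau_{0,N}^{\star,B}=1$ and $\tau_{b,N}^{\star,B}=\det\bigl[(\mathcal B_{N+\alpha-1}^\star)^{(\nu)}(0)\bigr]_{\alpha,\nu=1}^b$ for $1\le b\le q$. Upper factors: $U_b^\star$ ($1\le b\le q$) are the upper bidiagonal factors with unit first superdiagonal in the Christoffel–Gauss–Borel factorization $T^\star=L_1^\star\cdots L_p^\star U_q^\star\cdots U_1^\star$ of the step-line recurrence matrix $T^\star$ (defined by $T^\star\boldsymbol{\mathcal B}^\star=x\boldsymbol{\mathcal B}^\star$); when the tau-determinants do not vanish, their diagonal entries are $$(U_b^\star)_{N,N}=-\frac{\tau_{b-1,N}^{\star,B}\,\tau_{b,N+1}^{\star,B}}{\tau_{b-1,N+1}^{\star,B}\,\tau_{b,N}^{\star,B}}.$$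 Standing assumption: normality, i.e. all leading principal minors of $\mathscr M^\star$ are nonzero, so that the normalized forms exist and are unique, and nonzero pivots along the Christoffel chains. *)

(* Defs.v *)
From mathcomp Require Import all_boot all_order all_algebra.
From mathcomp Require Import all_classical all_reals all_analysis.
Set Implicit Arguments.
Unset Strict Implicit.
Unset Printing Implicit Defensive.
Import Order.TTheory GRing.Theory Num.Theory.
Import numFieldNormedType.Exports.
Local Open Scope classical_set_scope.
Local Open Scope ring_scope.

(* Every index is 0-based, except the superscripts a, b numbering the stages
   of a Christoffel chain and the bidiagonal factors: component, row or column
   number j of the text is j - 1 here. *)

Section Weights.
Context {R : realType}.

Definition Gamma (z : R) : R :=
  Rintegral lebesgue_measure `]0, +oo[ (fun t => t `^ (z - 1) * expR (- t)).

Definition beta_weight (a b x : R) : R :=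
  if 0 < x < 1 then x `^ a * (1 - x) `^ (b - a - 1) / Gamma (b - a) else 0.

Definition gamma_weight (a x : R) : R :=
  if 0 < x then x `^ a * expR (- x) else 0.

Definition mellin_conv (f g : R -> R) : R -> R := fun x =>
  Rintegral lebesgue_measure `]0, +oo[ (fun t => f t * g (x / t) / t).

(* The list is never empty below; mellin_conv has no unit function, hence the
   special treatment of the first factor. *)
Definition mellin_convs (fs : seq (R -> R)) : R -> R :=
  foldl mellin_conv (head (cst 0) fs) (behead fs).

Definition jacobi_w0 q (a b : 'rV[R]_q) : R -> R :=
  mellin_convs [seq beta_weight (a 0 j) (b 0 j) | j : 'I_q].

Definition laguerre_w0 r s (a : 'rV[R]_(r + s)) (b : 'rV[R]_r) : R -> R :=
  mellin_convs ([seq beta_weight (a 0 (lshift s h)) (b 0 h) | h : 'I_r]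
             ++ [seq gamma_weight (a 0 (rshift r l)) | l : 'I_s]).

Definition euler_op (f : R -> R) : R -> R := fun x => - x * derive1 f x.

Definition jacobi_row q (a b : 'rV[R]_q) (j : 'I_q) : R -> R :=
  jacobi_w0 a (b + delta_mx 0 j).

Definition laguerre_row r s (a : 'rV[R]_(r + s)) (b : 'rV[R]_r)
    (j : 'I_(r + s)) : R -> R :=
  match fintype.split j with
  | inl h => laguerre_w0 a (b + delta_mx 0 h)
  | inr l => iter l euler_op (laguerre_w0 a b)
  end.

End Weights.

(* The q x p matrix of weights with entries x ^ theta_i * V_j(x) on a domain. *)
Record mixed_system (R : realType) := MixedSystem {
  weights : seq (R -> R);
  exponents : seq R;
  domain : set R
}.

Section Families.
Context {R : realType}.

Definition jacobi_system p q (a b : 'rV[R]_q) (alpha : 'rV[R]_p) :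
    mixed_system R :=
  MixedSystem [seq jacobi_row a b j | j : 'I_q] [seq alpha 0 i | i : 'I_p]
    `]0, 1[.

Definition laguerre_system p r s (a : 'rV[R]_(r + s)) (b : 'rV[R]_r)
    (beta : 'rV[R]_p) : mixed_system R :=
  MixedSystem [seq laguerre_row a b j | j : 'I_(r + s)]
    [seq beta 0 i | i : 'I_p] `]0, +oo[.

Inductive jacobi_or_laguerre : mixed_system R -> Prop :=
| JacobiFamily p q (a b : 'rV[R]_q) (alpha : 'rV[R]_p) :
    (0 < p)%N -> (0 < q)%N ->
    (forall j, -1 < a 0 j < b 0 j) ->
    (forall i rho, -1 < alpha 0 i + a 0 rho) ->
    jacobi_or_laguerre (jacobi_system a b alpha)
| LaguerreIFamily p r s (a : 'rV[R]_(r + s)) (b : 'rV[R]_r)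
      (beta : 'rV[R]_p) :
    (0 < p)%N -> (0 < s)%N ->
    (forall j, -1 < a 0 j) -> (forall h, -1 < b 0 h) ->
    (forall h, a 0 (lshift s h) < b 0 h) ->
    (forall i rho, -1 < beta 0 i + a 0 rho) ->
    jacobi_or_laguerre (laguerre_system a b beta).

End Families.

Definition step_line (d N i : nat) : nat := (N %/ d + (i < N %% d))%N.

Section StepLine.
Context {R : realType}.
Implicit Type S : mixed_system R.

Definition nrows S : nat := size (weights S).
Definition ncols S : nat := size (exponents S).
Definition weight S (j : nat) : R -> R := nth (cst 0) (weights S) j.
Definition exponent S (i : nat) : R := nth 0 (exponents S) i.

Definition moment S (m n : nat) : R :=
  let q := nrows S in let p := ncols S in
  Rintegral lebesgue_measure (domain S) (fun x =>
    x `^ ((m %/ q)%:R + (n %/ p)%:R + exponent S (n %% p))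
    * weight S (m %% q) x).

Definition shifted_minor S (b N : nat) : R :=
  \det (\matrix_(i < N, j < N) moment S (b + i) j).

(* P j, for j < nrows S, is the component of the form along weight j. *)
Definition linear_form S (P : nat -> {poly R}) : R -> R := fun x =>
  \sum_(j < nrows S) (P j).[x] * weight S j x.

(* size (P j) <= d means degree at most d - 1, the zero polynomial if d = 0. *)
Record normalized_form S (N : nat) (P : nat -> {poly R}) : Prop := {
  form_degree : forall j, (j < nrows S)%N ->
    (size (P j) <= step_line (nrows S) N.+1 j)%N;
  form_orthogonal : forall i k, (i < ncols S)%N ->
    (k < step_line (ncols S) N i)%N ->
    Rintegral lebesgue_measure (domain S)
      (fun x => x `^ (exponent S i + k%:R) * linear_form S P x) = 0;
  form_normalized : let chi := (N %% nrows S)%N in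
    (P chi)`_(step_line (nrows S) N.+1 chi).-1 = 1
}.

Definition step_line_forms S (B : nat -> nat -> {poly R}) : Prop :=
  forall N, normalized_form S N (B N).

Definition tau (B : nat -> nat -> {poly R}) (b N : nat) : R :=
  \det (\matrix_(i < b, nu < b) (B (N + i)%N nu).[0]).

End StepLine.

Section InfiniteMatrices.
Context {R : realType}.

Definition infmx := nat -> nat -> R.

(* Finitely supported sums: they are the genuine products as soon as the left
   factor has finitely supported rows, as all the matrices below do. *)
Definition infmx_mul (A B : infmx) : infmx := fun i j =>
  \sum_(k \in [set: nat]) A i k * B k j.
Definition infmx_act (A : infmx) (f : nat -> R -> R) : nat -> R -> R :=
  fun i x => \sum_(k \in [set: nat]) A i k * f k x.
Definition infmx_id : infmx := fun i j => (i == j)%:R.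

Definition lower_bidiagonal (A : infmx) : Prop :=
  forall i j, i != j -> i != j.+1 -> A i j = 0.
Definition upper_bidiagonal1 (A : infmx) : Prop :=
  (forall i, A i i.+1 = 1) /\
  (forall i j, j != i -> j != i.+1 -> A i j = 0).

End InfiniteMatrices.

Section Christoffel.
Context {R : realType}.
Implicit Type S : mixed_system R.

(* Since B_N involves the moment rows 0..N only, row N of T vanishes beyond
   column N + q. *)
Definition recurrence_matrix S (B : nat -> nat -> {poly R}) (T : infmx) :=
  (forall N M, (N + nrows S < M)%N -> T N M = 0) /\
  (forall N x, domain S x ->
    infmx_act T (fun M => linear_form S (B M)) N x
    = x * linear_form S (B N) x).

(* (V_1, ..., V_q) |-> (V_2, ..., V_q, x V_1): deletes the first row of the
   moment matrix. *)
Definition row_christoffel S : mixed_system R :=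
  MixedSystem (if weights S is V :: Vs then rcons Vs (fun x => x * V x)
               else [::])
    (exponents S) (domain S).

(* (x^theta_1, ..., x^theta_p) |-> (x^theta_2, ..., x^theta_p, x^(theta_1+1)):
   deletes the first column of the moment matrix. *)
Definition col_christoffel S : mixed_system R :=
  MixedSystem (weights S)
    (if exponents S is t :: ts then rcons ts (t + 1) else [::])
    (domain S).

(* A maps the forms B of S to the forms B' of S', as functions. *)
Definition connects (A : infmx) S (B : nat -> nat -> {poly R})
    S' (B' : nat -> nat -> {poly R}) : Prop :=
  forall N x, domain S x ->
    infmx_act A (fun M => linear_form S (B M)) N x = linear_form S' (B' N) x.

(* T = L_1 ... L_p U_q ... U_1, where U_b is the connection matrix from the
   normalized forms of the (b-1)-st row Christoffel transform to those of the
   b-th one, and L_a the connection matrix from the a-th column transform back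
   to the (a-1)-st one.  The bare factorization of T into bidiagonal matrices
   would not determine the individual factors. *)
Record christoffel_gauss_borel S (T : infmx) (L U : nat -> infmx) : Prop := {
  cgb_lower : forall a, (1 <= a <= ncols S)%N -> lower_bidiagonal (L a);
  cgb_upper : forall b, (1 <= b <= nrows S)%N -> upper_bidiagonal1 (U b);
  cgb_rows : exists C : nat -> nat -> nat -> {poly R},
    (forall b, (b <= nrows S)%N ->
       step_line_forms (iter b row_christoffel S) (C b)) /\
    (forall b, (b < nrows S)%N ->
       connects (U b.+1) (iter b row_christoffel S) (C b)
                         (iter b.+1 row_christoffel S) (C b.+1));
  cgb_cols : exists C : nat -> nat -> nat -> {poly R},
    (forall a, (a <= ncols S)%N ->
       step_line_forms (iter a col_christoffel S) (C a)) /\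
    (forall a, (a < ncols S)%N ->
       connects (L a.+1) (iter a.+1 col_christoffel S) (C a.+1)
                         (iter a col_christoffel S) (C a));
  cgb_factorization : forall N M, T N M =
    infmx_mul (\big[infmx_mul/infmx_id]_(a <- iota 1 (ncols S)) L a)
              (\big[infmx_mul/infmx_id]_(b <- rev (iota 1 (nrows S))) U b)
              N M
}.

End Christoffel.

Arguments infmx R : clear implicits.

(* Main.v *)
From HB Require Import structures.
Require Import Defs.
From mathcomp Require Import all_boot all_order all_algebra.
From mathcomp Require Import all_classical all_reals all_analysis measurable_realfun.
From mathcomp Require Import ring lra zify.
Import Order.TTheory GRing.Theory Num.Theory.
Import numFieldNormedType.Exports.
Set Implicit Arguments.
Unset Strict Implicit.
Unset Printing Implicit Defensive.
Local Open Scope classical_set_scope.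
Local Open Scope ring_scope.

                                                                              
                                                                               
                                                                                
                                                        
                                                                             
                                                                                
                                                                                
                                                      
                                                                           
                                                                              
                                                      
                                                                                 
                                                                               
                                                                   

                                                            

(** Listed in step-line order, the coefficients of the normalized forms make a lower triangular
    matrix [c] with unit diagonal, and orthogonality says that [c M] is upper triangular, where [M]
    is the moment matrix. Both formulas are linear algebra on this Gauss factorization.

    Tau formula. Among the first b + N rows, put the first b unit columns to the left of the first N
    columns of [M]. The determinant is the minor of [M] shifted by b rows, and multiplication by [c]
    does not change it. After that multiplication, rows N, ..., N + b - 1 vanish on the last N
    columns. Moving them to the top costs the sign (-1)^(bN) and leaves a block lower triangular
    matrix, whose diagonal blocks are the tau matrix and the leading N x N block of [c M]; the
    latter has determinant Delta_{0,N} ([shifted_minor_tau]). As b is at most q, the constant terms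
    in tau are exactly the coefficients of the first b moment rows.

    Upper factors. The diagonal entries h_N of [c M] multiply up to the leading minors
    ([det_pivots]). A row Christoffel transform deletes the first moment row
    ([moment_row_christoffel]), so after b transforms h_N is Delta_{b,N+1} / Delta_{b,N}. In the
    connection relation, the new form N is [U N N] times the old form N plus the old form N + 1.
    Pairing it with moment column N kills the last term, so [U N N] is the quotient of the new h_N
    by the old one ([connects_pivot]).

    Analysis. Pairings expand into moments only if all the moment integrals converge
    ([jacobi_or_laguerre_integrable]). Beta and gamma weights have finite Mellin transforms, and the
    Mellin transform is multiplicative on convolutions. The Laguerre rows built with -x d/dx need
    differentiation under the integral sign: they stay in the span of the convolutions of one fixed
    function with gamma weights of exponents a, a + 1, a + 2, ... *)

Section Mellin.

(** * Mellin transforms and multiplicative convolution *)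

Context {R : realType}.
Notation GR := (measurableTypeR R).
Notation mu := (@lebesgue_measure R).
Notation pos := (`]0%R, +oo[%classic : set R).
Implicit Types (f g : R -> R) (a b c d e s t x y u : R).

Lemma lebesgue_measure_dilation t (A : set R) : 0 < t -> measurable A ->
  pushforward mu ((fun x => x / t) : _ -> measurableTypeR R) A
  = (t%:E * mu A)%E.
Proof.
move=> t0 mA.
have mphi : measurable_fun setT ((fun x => x / t) : R -> measurableTypeR R).
  exact: measurable_funM.
pose phi_mixin := isMeasurableFun.Build _ _ _ _ _ mphi.
pose phi : {mfun R >-> measurableTypeR R} := HB.pack (fun x : R => x / t) phi_mixin.
have ti0 : 0 <= t^-1 by rewrite invr_ge0 ltW.
(* Uniqueness of Lebesgue measure, applied to 1/t times the pushforward: it is enough to compare the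
   two on half-open intervals. *)
have H := @lebesgue_measure_unique R
  (mscale (NngNum ti0) (pushforward mu phi)).
rewrite H //; first by rewrite /mscale /= muleA -EFinM mulfV ?gt_eqF// mul1e.
move=> _ [[a b]] _ <-.
have E : (fun x => x / t) @^-1` `]a, b]%classic = `]a * t, b * t]%classic.
  by apply/seteqP; split=> x /=; rewrite !in_itv/= ltr_pdivlMr// ler_pdivrMr.
transitivity (t^-1%:E * mu ((fun x => x / t)%R @^-1` `]a, b]%classic))%E => //.
rewrite E.
rewrite !lebesgue_measure_itv/= !lte_fin ltr_pM2r//; case: ifPn => ab; last by rewrite mule0.
by rewrite -!EFinD -EFinM; congr (_ %:E); field; rewrite gt_eqF.
Qed.

Lemma ge0_integral_dilation t (h : R -> \bar R) : 0 < t ->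
  measurable_fun setT h -> (forall x, 0 <= h x)%E ->
  (\int[mu]_(x in pos) h (x / t)%R = t%:E * \int[mu]_(x in pos) h x)%E.
Proof.
move=> t0 mh h0.
have mphi : measurable_fun setT ((fun x => x / t) : measurableTypeR R -> measurableTypeR R).
  exact: measurable_funM.
have E : pos = ((fun x => x / t) : _ -> measurableTypeR R) @^-1` pos :> set R.
  by apply/seteqP; split=> x /=; rewrite !in_itv/= !andbT pmulr_lgt0 ?invr_gt0.
rewrite [in LHS]E -ge0_integral_pushforward //; last exact: measurable_funTS.
have t0' : 0 <= t by exact: ltW.
rewrite -(ge0_integral_mscale _ _ (NngNum t0')) //; last exact: measurable_funTS.
apply: eq_measure_integral => A mA _.
exact: lebesgue_measure_dilation.
Qed.

Definition nonneg_measurable f := measurable_fun setT f /\ forall x, 0 <= f x.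

Definition mellin f s : \bar R := (\int[mu]_(x in pos) (x `^ s * f x)%:E)%E.

                                                                                  
(** The integrand of the convolution as a function of both variables on the whole plane, in the form
    that Tonelli's theorem takes. The power with exponent -1 replaces the inverse because powers are
    known to be measurable; the two agree where [z.2] is positive. *)
Definition mellin_kernel f g (z : GR * GR) : \bar R :=
  if 0 < z.2 then (f z.2 * g (z.1 * z.2 `^ (-1)) * z.2 `^ (-1))%:E else 0%E.

Lemma mellin_kernel_ge0 f g z : nonneg_measurable f -> nonneg_measurable g ->
  (0 <= mellin_kernel f g z)%E.
Proof.
move=> [_ f0] [_ g0]; rewrite /mellin_kernel; case: ifP => // _.
by rewrite lee_fin !mulr_ge0 ?powR_ge0.
Qed.

Lemma measurable_mellin_kernel f g :
  nonneg_measurable f -> nonneg_measurable g ->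
  measurable_fun setT (mellin_kernel f g).
Proof.
move=> [mf _] [mg _]; rewrite /mellin_kernel.
apply: measurable_fun_ifT => //.
  apply: measurable_fun_ltr => //.
apply/measurable_EFinP.
have mp : measurable_fun setT (fun z : GR * GR => z.2 `^ (-1)).
  apply: (measurableT_comp (measurable_powR _)) => //.
apply: measurable_funM => //; apply: measurable_funM => //.
  exact: measurableT_comp.
by apply: (measurableT_comp mg); apply: measurable_funM.
Qed.

Lemma mellin_convE f g x :
  mellin_conv f g x = fine (\int[mu]_t mellin_kernel f g (x, t))%E.
Proof.
rewrite /mellin_conv /Rintegral integral_mkcond; congr fine.
apply: eq_integral => t _; rewrite /patch /mellin_kernel /= mem_setE in_itv/= andbT.
by case: ifPn => // t0; rewrite powR_inv1// ltW.
Qed.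

Lemma nonneg_measurable_mellin_conv f g :
  nonneg_measurable f -> nonneg_measurable g ->
  nonneg_measurable (mellin_conv f g).
Proof.
move=> hf hg; split; last first.
  move=> x; rewrite mellin_convE fine_ge0// integral_ge0// => t _.
  exact: mellin_kernel_ge0.
have -> : mellin_conv f g =
    fine \o (fubini_F mu (mellin_kernel f g)).
  by apply/funext => x; rewrite mellin_convE.
apply: measurableT_comp; first exact: fine_measurable.
apply: measurable_fun_fubini_tonelli_F => //.
- exact: measurable_mellin_kernel.
- by move=> z; exact: mellin_kernel_ge0.
Qed.

Lemma mellin_ge0 f s : nonneg_measurable f -> (0 <= mellin f s)%E.
Proof.
by move=> [_ f0]; apply: integral_ge0 => x _; rewrite lee_fin mulr_ge0 ?powR_ge0.
Qed.

Lemma measurable_mellin_integrand f s : nonneg_measurable f ->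
  measurable_fun setT (fun x => x `^ s * f x).
Proof. by move=> [mf _]; apply: measurable_funM. Qed.

                                                                       
                                                                         
                                                         
(** Tonelli and the dilation x = t y would give an equality. Only an inequality is claimed because
    [mellin_conv] is real-valued and takes the value 0 where its inner integral diverges; an upper
    bound is enough for finiteness. *)
Lemma mellin_mellin_conv f g s :
  nonneg_measurable f -> nonneg_measurable g ->
  (mellin (mellin_conv f g) s <= mellin f s * mellin g s)%E.
Proof.
move=> hf hg; have [mf f0] := hf; have [mg g0] := hg.
pose H (z : GR * GR) : \bar R :=
  if 0 < z.1 then ((z.1 `^ s)%:E * mellin_kernel f g z)%E else 0%E.
have mH : measurable_fun setT H.
  apply: measurable_fun_ifT => //; first exact: measurable_fun_ltr.
  apply: emeasurable_funM; last exact: measurable_mellin_kernel.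
  apply/measurable_EFinP.
  apply: (measurableT_comp (measurable_powR _)) => //.
have H0 z : (0 <= H z)%E.
  rewrite /H; case: ifP => // _; apply: mule_ge0; last exact: mellin_kernel_ge0.
  by rewrite lee_fin powR_ge0.
apply: (@le_trans _ _ (\int[mu]_x \int[mu]_t H (x, t))%E).
  rewrite /mellin integral_mkcond; apply: ge0_le_integral => //.
  - move=> x _; rewrite /patch; case: ifP => // _.
    by rewrite lee_fin mulr_ge0 ?powR_ge0// (nonneg_measurable_mellin_conv hf hg).2.
  - apply/(measurable_restrictT _ _).1 => //.
    apply/measurable_EFinP; apply: measurable_funTS; apply: measurable_mellin_integrand.
    exact: nonneg_measurable_mellin_conv.
  - change (measurable_fun setT (fubini_F mu H)); exact: measurable_fun_fubini_tonelli_F.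
  - move=> x _; rewrite /patch mem_setE in_itv/= andbT /H/=.
    case: ifP => x0; last by rewrite integral0.
    rewrite ge0_integralZl//; last 3 first.
    + apply: measurableT_comp; [exact: measurable_mellin_kernel|exact: pair1_measurable].
    + by move=> t _; exact: mellin_kernel_ge0.
    + by rewrite lee_fin powR_ge0.
    rewrite EFinM; apply: lee_wpmul2l; first by rewrite lee_fin powR_ge0.
    rewrite mellin_convE.
    have : (0 <= \int[mu]_t mellin_kernel f g (x, t))%E.
      by apply: integral_ge0 => t _; exact: mellin_kernel_ge0.
    by case: (\int[mu]_t _)%E => //= _; rewrite leey.
rewrite (fubini_tonelli H)//.
have mg' : measurable_fun setT (fun y => (y `^ s * g y)%:E).
  by apply/measurable_EFinP; exact: measurable_mellin_integrand.
rewrite [mellin f s]/mellin -ge0_integralZr//; last 3 first.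
- by apply: measurable_funTS; apply/measurable_EFinP; exact: measurable_mellin_integrand.
- by move=> x _; rewrite lee_fin mulr_ge0 ?powR_ge0.
- exact: mellin_ge0.
rewrite [leRHS]integral_mkcond le_eqVlt; apply/orP; left; apply/eqP.
apply: eq_integral => t _; rewrite /patch mem_setE in_itv/= andbT /H/= /mellin_kernel/=.
case: ifPn => t0; last first.
  by under eq_integral do rewrite mule0 if_same; rewrite integral0.
(* Splitting x^s as t^s (x/t)^s isolates a function of x/t; the factor t produced by the dilation
   then cancels the 1/t. *)
transitivity (\int[mu]_(x in pos) ((t `^ s * f t / t)%:E * ((x / t) `^ s * g (x / t))%:E))%E.
  rewrite [RHS]integral_mkcond; apply: eq_integral => x _.
  rewrite /patch mem_setE in_itv/= andbT; case: ifPn => // x0.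
  rewrite -!EFinM; congr (_ %:E); rewrite powR_inv1 ?ltW//.
  have -> : x `^ s = (x / t) `^ s * t `^ s.
    by rewrite -powRM ?divrK ?unitfE ?gt_eqF// ltW// divr_gt0.
  ring.
have c0 : 0 <= t `^ s * f t / t by rewrite divr_ge0 ?mulr_ge0 ?powR_ge0 // ltW.
rewrite ge0_integralZl_EFin//; last first.
- apply: measurable_funTS.
  have md : measurable_fun setT ((fun x => x / t) : GR -> GR) by exact: measurable_funM.
  exact: (measurableT_comp mg' md).
- by move=> x _; rewrite lee_fin mulr_ge0 ?powR_ge0.
rewrite (ge0_integral_dilation t0 mg'); last first.
  by move=> x; rewrite lee_fin mulr_ge0 ?powR_ge0.
by rewrite muleA -EFinM divfK ?gt_eqF.
Qed.

(** * Finite Mellin transforms of the beta and gamma weights *)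

Lemma ge0_integral01_le f F (K : R) :
  measurable_fun setT f -> (forall x, 0 < x < 1 -> 0 <= f x) ->
  (forall x, 0 < x < 1 -> derivable f x 1) ->
  (forall x, 0 < x < 1 -> is_derive x 1 F (f x)) ->
  (forall x, 0 < x < 1 -> `|F x| <= K) ->
  (\int[mu]_(x in `]0%R, 1%R[) (f x)%:E <= (K + K)%:E)%E.
Proof.
move=> mf f0 df dF FK.
(* The integrand may blow up at both ends, so (0,1) is exhausted by compact intervals [e, 1 - e], on
   which the fundamental theorem gives at most 2K; monotone convergence concludes. The shift by 3
   keeps e at most 1/3, so that the intervals are nondegenerate. *)
pose e n : R := n.+3%:R^-1.
have e0 n : 0 < e n by rewrite invr_gt0.
have e3 n : e n <= 3^-1 by rewrite lef_pV2 ?posrE// ler_nat.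
pose A n : set R := `[e n, 1 - e n]%classic.
have A01 n x : A n x -> 0 < x < 1.
  rewrite /A/= in_itv/= => /andP[h1 h2]; have := e0 n; lra.
have UA : `]0%R, 1%R[%classic = \bigcup_n A n.
  apply/seteqP; split=> x /=; rewrite in_itv/=; last by move=> [n _] /A01.
  move=> /andP[x0 x1].
  pose m := Num.min x (1 - x).
  have m0 : 0 < m by rewrite lt_min x0 subr_gt0.
  exists (Num.truncn m^-1) => //.
  have em : e (Num.truncn m^-1) <= m.
    rewrite /e -[leRHS]invrK lef_pV2 ?posrE ?invr_gt0//.
    by rewrite (le_trans (ltW (truncnS_gt _)))// ler_nat ltnS -addn2 leq_addr.
  have := em; rewrite le_min => /andP[h1 h2].
  by rewrite /A/= in_itv/=; apply/andP; split; lra.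
rewrite UA; apply: cvge_le (ge0_nondecreasing_set_cvg_integral _ _ _ _).
- near=> n; rewrite (@continuous_FTC2 _ f F).
  + rewrite -EFinB lee_fin.
    have h1 : `|F (1 - e n)| <= K by apply: FK; have := e0 n; have := e3 n; lra.
    have h2 : `|F (e n)| <= K by apply: FK; have := e0 n; have := e3 n; lra.
    move: h1 h2; rewrite !ler_norml; lra.
  + have := e0 n; have := e3 n; lra.
  + apply: derivable_within_continuous => x xA; apply: df; exact: (A01 n).
  + have cF x : 0 < x < 1 -> F y @[y --> x] --> F x.
      move=> hx; apply: differentiable_continuous; apply/derivable1_diffP.
      by apply: ex_derive; exact: dF.
    have := e0 n; have := e3 n => h1 h2.
    split.
    * move=> x; rewrite in_itv/= => /andP[h3 h4].
      by apply: ex_derive; apply: dF; apply/andP; split; lra.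
    * by apply: cvg_at_right_filter; apply: cF; apply/andP; split; lra.
    * by apply: cvg_at_left_filter; apply: cF; apply/andP; split; lra.
  + move=> x; rewrite in_itv/= => /andP[h3 h4].
    rewrite derive1E; apply: derive_val; apply: dF.
    by have := e0 n; have := e3 n => h1 h2; apply/andP; split; lra.
- move=> n m nm; apply/subsetPset => x; rewrite /A/= !in_itv/= => /andP[h1 h2].
  have : e m <= e n by rewrite lef_pV2 ?posrE// ler_nat !ltnS.
  lra.
- by move=> n; exact: measurable_itv.
- by move=> n; apply: measurable_funTS; apply/measurable_EFinP.
- by move=> n x /A01 h; rewrite lee_fin f0.
Unshelve. all: by end_near. Qed.

Lemma measurable_onem_powR d : measurable_fun setT (fun x : R => (1 - x) `^ d).
Proof.
apply: (measurableT_comp (measurable_powR d)).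
exact: measurable_funB.
Qed.

Lemma is_derive_onem_powR d x : x < 1 ->
  is_derive x 1 (fun x : R => (1 - x) `^ d) (- (d * (1 - x) `^ (d - 1))).
Proof.
move=> x1.
have h1 : is_derive (1 - x) 1 (@powR R ^~ d) (d * (1 - x) `^ (d - 1)).
  by apply: is_derive1_powR; rewrite subr_gt0.
have h2 : is_derive x 1 (fun x : R => 1 - x) (0 - 1).
  exact: is_deriveB.
apply: (is_derive_eq
  (is_derive1_comp (f := @powR R ^~ d) (g := fun x : R => 1 - x) h1 h2)).
by rewrite sub0r mulrN1.
Qed.

(** The sum, unlike the product of the two powers, has an explicit bounded antiderivative;
    [powR_onem_le] reduces the beta integrand to it. *)
Lemma integral_powR_onem_lty c d : -1 < c -> -1 < d ->
  (\int[mu]_(x in `]0%R, 1%R[) (x `^ c + (1 - x) `^ d)%:E < +oo)%E.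
Proof.
move=> hc hd.
have c1 : 0 < c + 1 by lra.
have d1 : 0 < d + 1 by lra.
pose F x := (c + 1)^-1 * x `^ (c + 1) - (d + 1)^-1 * (1 - x) `^ (d + 1).
apply: le_lt_trans (ltry _).
apply: (@ge0_integral01_le _ F ((c + 1)^-1 + (d + 1)^-1)).
- by apply: measurable_funD => //; exact: measurable_onem_powR.
- by move=> x _; rewrite addr_ge0 ?powR_ge0.
- move=> x /andP[x0 x1]; apply: derivableD; apply: ex_derive.
    exact: is_derive1_powR.
  exact: is_derive_onem_powR.
- move=> x /andP[x0 x1]; rewrite /F.
  have h1 := is_derive1_powR (c + 1) x0.
  have h2 := is_derive_onem_powR (d + 1) x1.
  have h3 := is_deriveB (is_deriveZ (c + 1)^-1 h1) (is_deriveZ (d + 1)^-1 h2).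
  apply: (is_derive_eq h3).
  rewrite !addrK scalerN opprK /GRing.scale/= !mulrA !mulVf ?gt_eqF// !mul1r//.
- move=> x /andP[x0 x1]; rewrite /F.
  have p1 (y e : R) : 0 < y < 1 -> 0 < e -> 0 <= e^-1 * y `^ e <= e^-1.
    move=> /andP[y0 y1] e0; rewrite mulr_ge0 ?powR_ge0 ?invr_ge0 ?(ltW e0)//=.
    rewrite ger_pMr ?invr_gt0// -[leRHS](powRr0 y).
    by apply: ger_powR; [rewrite y0 ltW|exact: ltW].
  have := p1 x (c + 1); rewrite x0 x1 => /(_ isT c1) /andP[q1 q2].
  have := p1 (1 - x) (d + 1); rewrite subr_gt0 gtrDl oppr_lt0 x0 x1 => /(_ isT d1) /andP[q3 q4].
  rewrite ler_norml; apply/andP; split; lra.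
Qed.

Lemma powR_half_le y e : 2^-1 <= y <= 1 -> y `^ e <= 1 + 2^-1 `^ e.
Proof.
move=> /andP[y2 y1].
have y0 : 0 < y by lra.
have [e0|e0] := leP 0 e.
  apply: (@le_trans _ _ 1); last by rewrite lerDl powR_ge0.
  by rewrite -[leRHS](powRr0 y) ger_powR// y0.
apply: (@le_trans _ _ (2^-1 `^ e)); last by rewrite lerDr.
rewrite -[e]opprK !(powRN _ (- e)) lef_pV2 ?posrE ?powR_gt0 ?invr_gt0//.
apply: ge0_ler_powR => //; rewrite ?nnegrE; lra.
Qed.

(** One of x and 1 - x is at least 1/2, and its power is then bounded by [powR_half_le], whatever
    the sign of the exponent. *)
Lemma powR_onem_le x c d : 0 < x < 1 ->
  x `^ c * (1 - x) `^ d
    <= (1 + 2^-1 `^ c + (1 + 2^-1 `^ d)) * (x `^ c + (1 - x) `^ d).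
Proof.
move=> /andP[x0 x1].
have p1 := powR_ge0 x c; have p2 := powR_ge0 (1 - x) d.
have p3 := powR_ge0 2^-1 c; have p4 := powR_ge0 2^-1 d.
have [xh|xh] := leP x 2^-1.
- have := @powR_half_le (1 - x) d; rewrite (_ : _ <= _ <= _); last by apply/andP; split; lra.
  move=> /(_ isT) h; nra.
- have := @powR_half_le x c; rewrite (_ : _ <= _ <= _); last by apply/andP; split; lra.
  move=> /(_ isT) h; nra.
Qed.

Lemma Gamma_ge0 (z : R) : 0 <= Gamma z.
Proof.
by apply: Rintegral_ge0 => t _; rewrite mulr_ge0 ?powR_ge0 ?expR_ge0.
Qed.

Lemma nonneg_measurable_beta a b : nonneg_measurable (@beta_weight R a b).
Proof.
split; last first.
  move=> x; rewrite /beta_weight; case: ifP => // _.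
  by rewrite divr_ge0 ?mulr_ge0 ?powR_ge0 ?Gamma_ge0.
apply: measurable_fun_ifT => //.
  by apply: measurable_and; exact: measurable_fun_ltr.
apply: measurable_funM => //; apply: measurable_funM => //.
exact: measurable_onem_powR.
Qed.

Lemma nonneg_measurable_gamma a : nonneg_measurable (@gamma_weight R a).
Proof.
split; last first.
  by move=> x; rewrite /gamma_weight; case: ifP => // _; rewrite mulr_ge0 ?powR_ge0 ?expR_ge0.
apply: measurable_fun_ifT => //; first exact: measurable_fun_ltr.
apply: measurable_funM => //.
by apply: measurableT_comp => //; exact: measurable_funN.
Qed.

Lemma mellin_beta_lty a b s : a < b -> -1 < s + a ->
  (mellin (@beta_weight R a b) s < +oo)%E.
Proof.
move=> ab sa.
pose c := s + a; pose d := b - a - 1.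
have d1 : -1 < d by rewrite /d; lra.
pose K := (1 + 2^-1 `^ c + (1 + 2^-1 `^ d)) / Gamma (b - a).
have K0 : 0 <= K by rewrite divr_ge0 ?Gamma_ge0 ?addr_ge0 ?powR_ge0.
apply: (@le_lt_trans _ _
  (K%:E * \int[mu]_(x in `]0%R, 1%R[) (x `^ c + (1 - x) `^ d)%:E)%E); last first.
  by apply: lte_mul_pinfty => //; exact: integral_powR_onem_lty.
have mI : measurable_fun setT (fun x => (x `^ c + (1 - x) `^ d)%:E).
  by apply/measurable_EFinP/measurable_funD => //; exact: measurable_onem_powR.
rewrite -ge0_integralZl_EFin//; last 2 first.
- by move=> x _; rewrite lee_fin addr_ge0 ?powR_ge0.
- exact: measurable_funTS.
rewrite /mellin [leLHS]integral_mkcond [leRHS]integral_mkcond.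
apply: ge0_le_integral => //.
- move=> x _; rewrite /patch; case: ifP => // _.
  by rewrite lee_fin mulr_ge0 ?powR_ge0// (nonneg_measurable_beta a b).2.
- apply/(measurable_restrictT _ _).1 => //.
  apply/measurable_EFinP; apply: measurable_funTS.
  by apply: measurable_mellin_integrand; exact: nonneg_measurable_beta.
- apply/(measurable_restrictT _ _).1 => //; apply: measurable_funTS.
  exact: measurable_funeM.
- move=> x _; rewrite /patch !mem_setE !in_itv/= andbT /beta_weight.
  have [x01|x01] := boolP (0 < x < 1); last by rewrite mulr0 if_same.
  have /andP[x0 x1] := x01; rewrite x0 -EFinM lee_fin.
  rewrite !mulrA -powRD; last by rewrite (gt_eqF x0) implybT.
  rewrite -/c -/d /K [leRHS]mulrAC ler_wpM2r ?invr_ge0 ?Gamma_ge0//.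
  exact: powR_onem_le.
Qed.

Lemma powR_le_expR c : 0 <= c ->
  exists2 C : R, 0 < C & forall u, 0 < u -> u `^ c <= C * expR u.
Proof.
move=> c0; pose n := Num.truncn c.
(* From exp u >= 1 + u^(n+1)/(n+1)! with n the integer part of c: the term 1 covers u <= 1, and the
   power term covers u > 1. *)
exists (n.+1`!%:R); first by rewrite ltr0n fact_gt0.
move=> u u0; apply: (@le_trans _ _ (n.+1`!%:R * (1 + u ^+ n.+1 / n.+1`!%:R))); last first.
  by rewrite ler_pM2l ?ltr0n ?fact_gt0// expR_ge1Dxn// ltW.
rewrite mulrDr mulr1 mulrC divfK ?pnatr_eq0 -?lt0n ?fact_gt0//.
have u1 : 0 <= u ^+ n.+1 by rewrite exprn_ge0// ltW.
have [h|h] := leP u 1.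
  apply: (@le_trans _ _ 1); first by rewrite -(powRr0 u); apply: ger_powR => //; rewrite u0.
  have : 1 <= n.+1`!%:R :> R by rewrite ler1n fact_gt0.
  lra.
apply: (@le_trans _ _ (u ^+ n.+1)); last by rewrite lerDr ler0n.
by rewrite -powR_mulrn ?(ltW u0)//; apply: ler_powR; [exact: ltW|exact/ltW/truncnS_gt].
Qed.

Lemma mellin_gamma_lty a s : -1 < s + a ->
  (mellin (@gamma_weight R a) s < +oo)%E.
Proof.
move=> sa; pose c := s + a.
have [C C0 HC] := powR_le_expR (normr_ge0 c).
(* On (0,1) the integrand is at most x^c. For x >= 1, x^c <= 2^|c| (x/2)^|c| <= 2^|c| C exp(x/2),
   which leaves exp(-x/2); the last factor 2 turns this into the exponential density of rate 1/2,
   whose integral is 1. *)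
pose K := 2 `^ `|c| * C * 2.
have K0 : 0 <= K by rewrite !mulr_ge0 ?powR_ge0// ltW.
pose h1 := (fun x => (x `^ c + (1 - x) `^ 0)%:E) \_ `]0%R, 1%R[.
pose h2 x := (K%:E * (exponential_pdf 2^-1 x)%:E)%E.
have h10 x : (0 <= h1 x)%E.
  by rewrite /h1 /patch; case: ifP => // _; rewrite lee_fin addr_ge0 ?powR_ge0.
have h20 x : (0 <= h2 x)%E.
  by rewrite /h2 mule_ge0// lee_fin exponential_pdf_ge0// invr_ge0.
have mh1 : measurable_fun setT h1.
  apply/(measurable_restrictT _ _).1 => //; apply: measurable_funTS.
  by apply/measurable_EFinP/measurable_funD => //; exact: measurable_onem_powR.
have mpdf : measurable_fun setT (fun x => (exponential_pdf (2^-1 : R) x)%:E).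
  by apply/measurable_EFinP; exact: measurable_exponential_pdf.
have mh2 : measurable_fun setT h2 by exact: measurable_funeM.
apply: (@le_lt_trans _ _ (\int[mu]_x (h1 x + h2 x))%E); last first.
  rewrite ge0_integralD//; apply: lte_add_pinfty.
    rewrite -integral_mkcond; apply: integral_powR_onem_lty; [exact: sa|exact: ltrN10].
  rewrite ge0_integralZl_EFin//; last first.
    by move=> x _; rewrite lee_fin exponential_pdf_ge0// invr_ge0.
  by rewrite integral_exponential_pdf ?invr_gt0// mule1 ltry.
rewrite /mellin [leLHS]integral_mkcond.
apply: ge0_le_integral => //.
- move=> x _; rewrite /patch; case: ifP => // _.
  by rewrite lee_fin mulr_ge0 ?powR_ge0// (nonneg_measurable_gamma a).2.
- apply/(measurable_restrictT _ _).1 => //.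
  apply/measurable_EFinP; apply: measurable_funTS.
  by apply: measurable_mellin_integrand; exact: nonneg_measurable_gamma.
- exact: emeasurable_funD.
move=> x _; rewrite {1}/patch mem_setE in_itv/= andbT /gamma_weight.
have [x0|x0] := boolP (0 < x); last by rewrite adde_ge0.
rewrite mulrA -powRD ?(gt_eqF x0) ?implybT// -/c.
have [x1|x1] := ltP x 1.
  apply: le_trans (leeDl _ (h20 x)).
  rewrite /h1 /patch mem_setE in_itv/= x0 x1/= lee_fin.
  apply: (@le_trans _ _ (x `^ c)); last by rewrite lerDl powR_ge0.
  by rewrite ler_piMr ?powR_ge0// -expR0 ler_expR oppr_le0 ltW.
apply: le_trans (leeDr _ (h10 x)).
rewrite /h2 exponential_pdfE ?(ltW x0)// -EFinM lee_fin.
have -> : - x = x / 2 * -1 + - 2^-1 * x by field.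
rewrite expRD mulrN1 expRN /K -!mulrA.
have -> : forall z : R, 2 `^ `|c| * (C * (2 * (2^-1 * z))) = 2 `^ `|c| * C * z.
  by move=> z; field.
rewrite !mulrA ler_wpM2r ?expR_ge0// ler_pdivrMr ?expR_gt0//.
apply: (@le_trans _ _ (x `^ `|c|)); first by rewrite ler_powR// ler_norm.
have -> : x `^ `|c| = 2 `^ `|c| * (x / 2) `^ `|c|.
  by rewrite -powRM ?divr_ge0 ?(ltW x0)//; congr powR; field.
by rewrite -mulrA ler_wpM2l ?powR_ge0// HC// divr_gt0.
Qed.

Lemma mellin_integrable f s : nonneg_measurable f -> (mellin f s < +oo)%E ->
  mu.-integrable pos (fun x => (x `^ s * f x)%:E).
Proof.
move=> hf fs; apply/integrableP; split.
  by apply/measurable_EFinP; apply: measurable_funTS; exact: measurable_mellin_integrand.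
under eq_integral do rewrite gee0_abs ?lee_fin ?mulr_ge0 ?powR_ge0 ?hf.2//.
exact: fs.
Qed.

(** Written so that u d/du visibly maps the weight of exponent a to a combination of those of
    exponents a and a + 1. *)
Lemma is_derive_gamma_weight a u : 0 < u ->
  is_derive u 1 (@gamma_weight R a)
    (u^-1 * (a * gamma_weight a u - gamma_weight (a + 1) u)).
Proof.
move=> u0.
have h1 := is_derive1_powR a u0.
have h2 : is_derive u 1 (fun x : R => expR (- x)) (expR (- u) * -1).
  exact: (is_derive1_comp (f := expR) (g := -%R) (is_derive_expR (- u)) (is_deriveNid u 1)).
have h3 := is_deriveM h1 h2.
apply: (near_eq_is_derive _ (is_derive_eq h3 _)).
  near=> x; have x0 : 0 < x by near: x; exact: lt_nbhsr.
  by rewrite /gamma_weight x0.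
rewrite /gamma_weight u0 /GRing.scale/=.
have un0 : u != 0 by rewrite gt_eqF.
rewrite !powRD ?un0 ?implybT// powRN powRr1 ?(ltW u0)//.
by field.
Unshelve. all: by end_near. Qed.

(** * Differentiating a convolution with a gamma weight *)

Section Euler.
Variables (W : R -> R) (s0 : R).
Hypothesis hW : nonneg_measurable W.
Hypothesis momW : forall s, s0 < s -> (mellin W s < +oo)%E.

Let K a x t := W t * gamma_weight a (x / t) / t.

(** Exponential decay beats every power: u^a exp(-u) <= C u^(-k), and with u = x/t this is at most a
    constant times t^k, uniformly for x > x0/2. This uniformity supplies the dominating function
    when differentiating under the integral. *)
Lemma gamma_kernel_bound a x0 : 0 < x0 -> exists s C,
  [/\ s0 < s, 0 <= C & forall x t, x0 / 2 < x -> 0 < t ->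
    0 <= K a x t <= C * (t `^ s * W t)].
Proof.
move=> x00; pose k := `|a| + `|s0| + 2.
have k0 : 0 <= k by rewrite !addr_ge0.
have ak : 0 <= a + k.
  have := ler_norm (- a); rewrite normrN /k; have := normr_ge0 s0; lra.
have [C C0 HC] := powR_le_expR ak.
exists (k - 1), (C * (x0 / 2) `^ (- k)); split.
- have := ler_norm s0; have := normr_ge0 a; rewrite /k; lra.
- by rewrite mulr_ge0 ?powR_ge0// ltW.
move=> x t xx0 t0.
have x20 : 0 < x0 / 2 by rewrite divr_gt0.
have xp : 0 < x by exact: lt_trans xx0.
have W0 := hW.2 t.
have u0 : 0 < x / t by rewrite divr_gt0.
rewrite /K /gamma_weight u0; apply/andP; split.
  by rewrite divr_ge0 ?(ltW t0)// !mulr_ge0 ?powR_ge0 ?expR_ge0.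
have -> : C * (x0 / 2) `^ (- k) * (t `^ (k - 1) * W t) =
   W t * (C * (x0 / 2) `^ (- k) * t `^ k) / t.
  rewrite powRB ?(gt_eqF t0) ?implybT// powRr1 ?(ltW t0)//; field.
  by rewrite gt_eqF.
rewrite ler_wpM2r ?invr_ge0 ?(ltW t0)// ler_wpM2l//.
apply: (@le_trans _ _ (C * (x / t) `^ (- k))).
  rewrite expRN ler_pdivrMr ?expR_gt0//.
  have -> : a = (a + k) - k by rewrite addrK.
  rewrite powRB ?(gt_eqF u0) ?implybT// powRN mulrAC ler_wpM2r ?invr_ge0 ?powR_ge0//.
  exact: HC.
rewrite -mulrA ler_wpM2l ?(ltW C0)//.
rewrite powRM ?(ltW xp) ?invr_ge0 ?(ltW t0)//.
rewrite -[t^-1]powR_inv1 ?(ltW t0)// -powRrM mulrN mulN1r opprK.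
rewrite ler_wpM2r ?powR_ge0// !powRN lef_pV2 ?posrE ?powR_gt0//.
by apply: ge0_ler_powR => //; rewrite ?nnegrE; exact: ltW.
Qed.

Lemma integrable_gamma_kernel a x : 0 < x -> mu.-integrable pos (EFin \o K a x).
Proof.
move=> x0; have [s [C [s1 C0 H]]] := gamma_kernel_bound a x0.
have xx : x / 2 < x by lra.
have iG : mu.-integrable pos (fun t => (C%:E * (t `^ s * W t)%:E)%E).
  by apply: integrableZl => //; apply: mellin_integrable => //; exact: momW.
apply: (le_integrable _ _ _ iG) => //.
  apply/measurable_EFinP.
  apply: (eq_measurable_fun (fun t => W t * gamma_weight a (x * t `^ (-1)) * t `^ (-1))).
    by move=> t; rewrite inE/= in_itv/= andbT => t0; rewrite /K powR_inv1// ltW.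
  apply: measurable_funTS; apply: measurable_funM => //; apply: measurable_funM.
    exact: hW.1.
  apply: (measurableT_comp (nonneg_measurable_gamma a).1).
  exact: measurable_funM.
move=> t; rewrite /= in_itv/= andbT => t0.
have /andP[h1 h2] := H x t xx t0.
rewrite ger0_norm// lee_fin ger0_norm//.
by rewrite (le_trans h1).
Qed.

Lemma is_derive_conv_gamma a x : 0 < x ->
  is_derive x 1 (mellin_conv W (gamma_weight a))
   (x^-1 * (a * mellin_conv W (gamma_weight a) x
            - mellin_conv W (gamma_weight (a + 1)) x)).
Proof.
move=> x0.
have [s [C [s1 C0 H]]] := gamma_kernel_bound a x0.
have [s' [C' [s1' C0' H']]] := gamma_kernel_bound (a + 1) x0.
pose I := (x / 2, x * 2).
have xI : `]I.1, I.2[%classic x by rewrite /= in_itv/=; apply/andP; split; lra.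
have posI y : `]I.1, I.2[%classic y -> x / 2 < y /\ 0 < y.
  by rewrite /= in_itv/= => /andP[]; split; lra.
(* Dominates the x-derivative of the kernel on (x/2, 2x): its prefactor 1/y is at most 1/(x/2), and
   the kernels of exponents a and a + 1 are bounded separately. *)
pose G t := (x / 2)^-1 * (`|a| * (C * (t `^ s * W t)) + C' * (t `^ s' * W t)).
have dK y t : 0 < y -> 0 < t -> is_derive y 1 (fun z => K a z t)
    (y^-1 * (a * K a y t - K (a + 1) y t)).
  move=> y0 t0.
  have u0 : 0 < y / t by rewrite divr_gt0.
  have h1 := is_derive_gamma_weight a u0.
  have h2 : is_derive y 1 (fun z : R => z / t) (t^-1).
    have -> : (fun z : R => z / t) = t^-1 *: (id : R -> R).
      by apply/funext => z; rewrite mulrC.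
    by apply: (is_derive_eq (is_deriveZ _ (is_derive_id y 1))); rewrite /GRing.scale/= mulr1.
  have h3 := is_derive1_comp (f := gamma_weight a) (g := fun z : R => z / t) h1 h2.
  have -> : (fun z => K a z t) = (W t / t) *: (gamma_weight a \o (fun z : R => z / t)).
    by apply/funext => z; rewrite /K mulrAC.
  apply: (is_derive_eq (is_deriveZ _ h3)); rewrite /K /GRing.scale/=.
  by field; rewrite !gt_eqF.
have intK y : `]I.1, I.2[%classic y -> mu.-integrable pos (EFin \o K a y).
  by move=> /posI[_ y0]; exact: integrable_gamma_kernel.
have derK y t : `]I.1, I.2[%classic y -> pos t -> derivable (K a ^~ t) y 1.
  move=> /posI[_ y0]; rewrite /= in_itv/= andbT => t0.
  by apply: ex_derive; exact: dK.
have p1E y t : 0 < y -> 0 < t -> partial1of2 (K a) y t = y^-1 * (a * K a y t - K (a + 1) y t).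
  move=> y0 t0; rewrite partial1of2E; apply: derive_val; exact: dK.
have W0 := hW.2.
have G0 t : 0 <= G t.
  rewrite /G mulr_ge0 ?invr_ge0 ?divr_ge0 ?(ltW x0)// addr_ge0//.
    by rewrite !mulr_ge0 ?powR_ge0.
  by rewrite !mulr_ge0 ?powR_ge0.
have iW r : s0 < r -> mu.-integrable pos (fun t => (t `^ r * W t)%:E).
  by move=> r0; apply: mellin_integrable => //; exact: momW.
have intG : mu.-integrable pos (EFin \o G).
  have -> : EFin \o G = (fun t => (x / 2)^-1%:E *
      ((`|a| * C)%:E * (t `^ s * W t)%:E + C'%:E * (t `^ s' * W t)%:E))%E.
    by apply/funext => t; rewrite /G /= mulrA.
  apply: integrableZl => //; apply: integrableD => //.
    by apply: integrableZl => //; exact: iW.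
  by apply: integrableZl => //; exact: iW.
have GK y t : `]I.1, I.2[%classic y -> pos t -> `|partial1of2 (K a) y t| <= G t.
  move=> /posI[yx y0]; rewrite /= in_itv/= andbT => t0.
  rewrite p1E// normrM gtr0_norm ?invr_gt0//.
  apply: ler_pM => //.
  - by rewrite invr_ge0 ltW.
  - by rewrite lef_pV2 ?posrE ?divr_gt0 ?(ltW yx).
  have /andP[h1 h2] := H _ _ yx t0.
  have /andP[h3 h4] := H' _ _ yx t0.
  apply: (le_trans (ler_normB _ _)); apply: lerD; last by rewrite ger0_norm.
  by rewrite normrM (ger0_norm h1) ler_wpM2l.
apply: DeriveDef.
  exact: (@derivable_under_integral _ _ _ mu (K a) pos _ x I.1 I.2 xI intK derK G G0 intG GK).
rewrite -derive1E.
rewrite (@differentiation_under_integral _ _ _ mu (K a) pos _ x I.1 I.2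
  xI intK derK G G0 intG GK)//.
transitivity (\int[mu]_(t in pos) (x^-1 * (a * K a x t - K (a + 1) x t))).
  apply: eq_Rintegral => t; rewrite inE/= in_itv/= andbT => t0.
  exact: p1E.
have i1 := integrable_gamma_kernel a x0.
have i2 := integrable_gamma_kernel (a + 1) x0.
have i3 : mu.-integrable pos (EFin \o (fun t => a * K a x t)).
  rewrite (_ : _ \o _ = (fun t => a%:E * (EFin \o K a x) t)%E) //.
  exact: integrableZl.
rewrite RintegralZl//; last first.
  rewrite (_ : _ \o _ = ((EFin \o (fun t => a * K a x t)%R) \- (EFin \o K (a + 1)%R x))%E) //.
  exact: integrableB.
by rewrite RintegralB// RintegralZl.
Qed.

End Euler.

End Mellin.

(** * Convergence of all the moments of the two families *)

Section Weights.
Context {R : realType}.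
Notation mu := (@lebesgue_measure R).
Notation pos := (`]0%R, +oo[%classic : set R).
Implicit Types (f g h W : R -> R) (a b c d e s t x y u : R).

(** Linear span up to equality on the positive half-line, the only place where the derivative
    formulas are available. *)
Inductive span_on_pos (F : nat -> R -> R) : (R -> R) -> Prop :=
| span_gen k h : (forall x, 0 < x -> h x = F k x) -> span_on_pos F h
| span_comb c h1 h2 h : span_on_pos F h1 -> span_on_pos F h2 ->
    (forall x, 0 < x -> h x = c * h1 x + h2 x) -> span_on_pos F h.

Lemma eq_pos_is_derive f g x df : 0 < x -> (forall y, 0 < y -> g y = f y) ->
  is_derive x 1 f df -> is_derive x 1 g df.
Proof.
move=> x0 gf; apply: near_eq_is_derive.
by near=> y; rewrite gf//; near: y; exact: lt_nbhsr.
Unshelve. all: by end_near. Qed.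

(** On generators, -x d/dx sends F_k to -(a + k) F_k + F_(k+1). Differentiability is proved in the
    same induction, since the derivative of a combination splits only when both terms are
    differentiable. *)
Lemma span_euler_op W a s0 h :
  nonneg_measurable W -> (forall s, s0 < s -> (mellin W s < +oo)%E) ->
  let F k := mellin_conv W (gamma_weight (a + k%:R)) in
  span_on_pos F h ->
  (forall x, 0 < x -> derivable h x 1) /\ span_on_pos F (euler_op h).
Proof.
move=> hW momW F; elim=> {h} [k h hk|c h1 h2 h _ [d1 s1] _ [d2 s2] hh].
  have dh x : 0 < x ->
      is_derive x 1 h (x^-1 * ((a + k%:R) * F k x - F k.+1 x)).
    move=> x0; apply: (eq_pos_is_derive x0 hk).
    have := is_derive_conv_gamma hW momW (a + k%:R) x0.
    by rewrite -addrA natr1.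
  split; first by move=> x x0; apply: ex_derive; exact: dh.
  apply: (@span_comb F (- (a + k%:R)) (F k) (F k.+1)).
  - exact: (@span_gen F k).
  - exact: (@span_gen F k.+1).
  - move=> x x0; rewrite /euler_op derive1E.
    rewrite (@derive_val _ _ _ _ _ _ _ (dh _ x0)).
    by rewrite mulNr mulrA mulfV ?gt_eqF// mul1r; ring.
have dh x : 0 < x -> is_derive x 1 h (c * 'D_1 h1 x + 'D_1 h2 x).
  move=> x0; apply: (@eq_pos_is_derive (c *: h1 + h2)) => //.
  apply: is_deriveD; last exact: (derivableP (d2 x x0)).
  by apply: is_deriveZ; exact: (derivableP (d1 x x0)).
split; first by move=> x x0; apply: ex_derive; exact: dh.
apply: (span_comb s1 s2 (c := c)) => x x0; rewrite /euler_op !derive1E.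
rewrite (@derive_val _ _ _ _ _ _ _ (dh _ x0)).
ring.
Qed.

Lemma span_iter_euler_op W a s0 n :
  nonneg_measurable W -> (forall s, s0 < s -> (mellin W s < +oo)%E) ->
  span_on_pos (fun k => mellin_conv W (gamma_weight (a + k%:R)))
    (iter n euler_op (mellin_conv W (gamma_weight a))).
Proof.
move=> hW momW; elim: n => [|n IHn] /=.
  by apply: (@span_gen _ 0%N) => x _; rewrite addr0.
exact: (span_euler_op hW momW IHn).2.
Qed.

Lemma span_integrable (F : nat -> R -> R) h s :
  (forall k, mu.-integrable pos (fun x => (x `^ s * F k x)%:E)) ->
  span_on_pos F h -> mu.-integrable pos (fun x => (x `^ s * h x)%:E).
Proof.
move=> iF; elim=> {h} [k h hk|c h1 h2 h _ i1 _ i2 hh].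
  apply: (eq_integrable _ _ _ _ (iF k)) => // x.
  by rewrite inE/= in_itv/= andbT => x0; rewrite hk.
have i3 : mu.-integrable pos
    (fun x => c%:E * (x `^ s * h1 x)%:E + (x `^ s * h2 x)%:E)%E.
  by apply: integrableD => //; exact: integrableZl.
apply: (eq_integrable _ _ _ _ i3) => // x.
rewrite inE/= in_itv/= andbT => x0; rewrite hh// -EFinM -EFinD.
by congr (_ %:E); ring.
Qed.

Definition mellin_finite s f := nonneg_measurable f /\ (mellin f s < +oo)%E.

Lemma mellin_finite_conv s f g : mellin_finite s f -> mellin_finite s g ->
  mellin_finite s (mellin_conv f g).
Proof.
move=> [hf ff] [hg fg]; split; first exact: nonneg_measurable_mellin_conv.
apply: (le_lt_trans (mellin_mellin_conv _ hf hg)).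
by apply: lte_mul_pinfty => //; [exact: mellin_ge0|rewrite ge0_fin_numE ?mellin_ge0].
Qed.

Lemma mellin_finite_convs s (fs : seq (R -> R)) : (0 < size fs)%N ->
  (forall i, (i < size fs)%N -> mellin_finite s (nth (cst 0) fs i)) ->
  mellin_finite s (mellin_convs fs).
Proof.
case: fs => // f fs _ H; rewrite /mellin_convs/=.
have : mellin_finite s f by exact: (H 0%N).
have {H} : forall i, (i < size fs)%N -> mellin_finite s (nth (cst 0) fs i).
  by move=> i ifs; exact: (H i.+1).
elim: fs f => //= g fs IH f H hf; apply: IH.
  by move=> i ifs; exact: (H i.+1).
by apply: mellin_finite_conv => //; exact: (H 0%N).
Qed.

Lemma mellin_convs_rcons (fs : seq (R -> R)) g : (0 < size fs)%N ->
  mellin_convs (rcons fs g) = mellin_conv (mellin_convs fs) g.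
Proof. by case: fs => // f fs _; rewrite /mellin_convs/= foldl_rcons. Qed.

Lemma nth_codom_ord (T : Type) (x0 : T) n (F : 'I_n -> T) (j : 'I_n) :
  nth x0 [seq F i | i : 'I_n] j = F j.
Proof.
by rewrite (nth_map j) ?size_enum_ord// nth_ord_enum.
Qed.

(** The analytic input of the algebraic part. All powers k are included so that the property
    survives a row Christoffel transform; positivity of the domain lets real exponents be added. *)
Definition integrable_system (S : mixed_system R) : Prop :=
  [/\ measurable (domain S), domain S `<=` pos,
      (0 < nrows S)%N, (0 < ncols S)%N &
      forall i j k, (i < ncols S)%N -> (j < nrows S)%N ->
        mu.-integrable (domain S)
          (fun x => (x `^ (k%:R + exponent S i) * weight S j x)%:E)].

Lemma jacobi_integrable p q (a b : 'rV[R]_q) (alpha : 'rV[R]_p) :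
  (0 < p)%N -> (0 < q)%N -> (forall j, -1 < a 0 j < b 0 j) ->
  (forall i rho, -1 < alpha 0 i + a 0 rho) ->
  integrable_system (jacobi_system a b alpha).
Proof.
move=> p0 q0 hab hal; split => //=.
- by move=> x /=; rewrite !in_itv/= => /andP[->].
- by rewrite /nrows size_image card_ord.
- by rewrite /ncols size_image card_ord.
move=> i j k; rewrite /ncols /nrows /= !size_image !card_ord => hi hj.
rewrite /exponent /weight/= (nth_codom_ord _ _ (Ordinal hi)) (nth_codom_ord _ _ (Ordinal hj)).
set s := k%:R + _.
suff ipos : mu.-integrable pos (fun x => (x `^ s * jacobi_row a b (Ordinal hj) x)%:E).
  apply: (integrableS _ _ _ ipos) => //.
  by move=> x /=; rewrite !in_itv/= => /andP[->].
suff [h1 h2] : mellin_finite s (jacobi_row a b (Ordinal hj)).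
  exact: mellin_integrable.
rewrite /jacobi_row /jacobi_w0; apply: mellin_finite_convs.
  by rewrite size_image card_ord.
rewrite size_image card_ord => m hm; rewrite (nth_codom_ord _ _ (Ordinal hm)).
split; first exact: nonneg_measurable_beta.
apply: mellin_beta_lty; last first.
  have := hal (Ordinal hi) (Ordinal hm); rewrite /s; have := ler0n R k; lra.
rewrite !mxE; have /andP[_ h] := hab (Ordinal hm).
by rewrite (lt_le_trans h)// lerDl ler0n.
Qed.

Section Laguerre.
Variables (r s : nat) (a : 'rV[R]_(r + s)).

(** The map [F] selects gamma factors: the identity gives the full weight, and an initial inclusion
    gives the weight without its last gamma factor. *)
Lemma mellin_finite_factors (b : 'rV[R]_r) t n (F : 'I_n -> 'I_s) :
  (0 < r + n)%N -> (forall i, a 0 (lshift s i) < b 0 i) ->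
  (forall rho, -1 < t + a 0 rho) ->
  mellin_finite t (mellin_convs
    ([seq beta_weight (a 0 (lshift s i)) (b 0 i) | i : 'I_r]
       ++ [seq gamma_weight (a 0 (rshift r (F l))) | l : 'I_n])).
Proof.
move=> rn hb ht; apply: mellin_finite_convs.
  by rewrite size_cat !size_image !card_ord.
rewrite size_cat !size_image !card_ord => i hi; rewrite nth_cat size_image card_ord.
case: ltnP => ir.
  rewrite (nth_codom_ord _ _ (Ordinal ir)); split; first exact: nonneg_measurable_beta.
  exact: mellin_beta_lty.
have hi' : (i - r < n)%N by rewrite ltn_subLR.
rewrite (nth_codom_ord _ _ (Ordinal hi')).
by split; [exact: nonneg_measurable_gamma|exact: mellin_gamma_lty].
Qed.

End Laguerre.

Lemma laguerre_w0_rcons (r s : nat) (a : 'rV[R]_(r + s.+1)) (b : 'rV[R]_r) :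
  (0 < r + s)%N ->
  laguerre_w0 a b = mellin_conv (mellin_convs
    ([seq beta_weight (a 0 (lshift s.+1 i)) (b 0 i) | i : 'I_r]
       ++ [seq gamma_weight (a 0 (rshift r (widen_ord (leqnSn s) l))) | l : 'I_s]))
    (gamma_weight (a 0 (rshift r ord_max))).
Proof.
move=> rs; rewrite -mellin_convs_rcons; last first.
  by rewrite size_cat !size_image !card_ord.
rewrite rcons_cat /laguerre_w0 /image_mem enum_ordSr map_rcons.
by congr (mellin_convs (_ ++ rcons _ _)); rewrite -map_comp.
Qed.

(** Rows without derivatives are plain convolutions. For the others, the last gamma factor is split
    off and absorbs every -x d/dx, at the price of raising its exponent, which keeps the moments
    finite. *)
Lemma laguerre_row_integrable (r s : nat) (a : 'rV[R]_(r + s)) (b : 'rV[R]_r) t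
    (j : 'I_(r + s)) :
  (0 < s)%N -> (forall i, a 0 (lshift s i) < b 0 i) ->
  (forall rho, -1 < t + a 0 rho) ->
  mu.-integrable pos (fun x => (x `^ t * laguerre_row a b j x)%:E).
Proof.
case: s a j => // s a j _ hb ht; rewrite /laguerre_row; case: fintype.splitP => [h _|l _].
  suff [] : mellin_finite t (laguerre_w0 a (b + delta_mx 0 h)).
    exact: mellin_integrable.
  apply: (@mellin_finite_factors _ _ _ _ _ _ id) => //; first by rewrite addnS.
  by move=> i; rewrite !mxE (lt_le_trans (hb i))// lerDl ler0n.
case: l => -[|l] hl.
  suff [] : mellin_finite t (laguerre_w0 a b) by exact: mellin_integrable.
  by apply: (@mellin_finite_factors _ _ _ _ _ _ id) => //; rewrite addnS.
(* A row with a derivative exists only if there are at least two gamma factors, so a nonempty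
   convolution remains after splitting one off. *)
have rs : (0 < r + s)%N by rewrite addn_gt0 (leq_ltn_trans (leq0n l) (hl : (l < s)%N)) orbT.
rewrite laguerre_w0_rcons//; set W := mellin_convs _.
have hW u : (forall rho, -1 < u + a 0 rho) -> mellin_finite u W.
  by move=> hu; exact: (@mellin_finite_factors _ _ a b u s (widen_ord (leqnSn s))).
apply: (@span_integrable
  (fun k => mellin_conv W (gamma_weight (a 0 (rshift r ord_max) + k%:R)))).
  move=> k; apply: mellin_integrable.
    by apply: nonneg_measurable_mellin_conv; [exact: (hW t ht).1|exact: nonneg_measurable_gamma].
  have [] // : mellin_finite t (mellin_conv W (gamma_weight (a 0 (rshift r ord_max) + k%:R))).
  apply: mellin_finite_conv; first exact: hW.
  split; first exact: nonneg_measurable_gamma.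
  apply: mellin_gamma_lty.
  by rewrite addrA; apply: (lt_le_trans (ht (rshift r ord_max))); rewrite lerDl ler0n.
(* Above this threshold u + a_rho is positive for every rho, so all moments of [W] of such orders
   are finite. *)
apply: (@span_iter_euler_op _ _ (\sum_rho `|a 0 rho|)); first exact: (hW t ht).1.
move=> u hu; apply: (hW u _).2 => rho.
have : - a 0 rho <= \sum_i `|a 0 i|.
  rewrite (bigD1 rho)//= (le_trans (ler_norm _))// normrN lerDl.
  by rewrite sumr_ge0.
lra.
Qed.

Lemma laguerre_integrable (p r s : nat) (a : 'rV[R]_(r + s)) (b : 'rV[R]_r)
    (beta : 'rV[R]_p) :
  (0 < p)%N -> (0 < s)%N ->
  (forall i, a 0 (lshift s i) < b 0 i) ->
  (forall i rho, -1 < beta 0 i + a 0 rho) ->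
  integrable_system (laguerre_system a b beta).
Proof.
move=> p0 s0 hab hal; split => //=.
- by rewrite /nrows size_image card_ord addn_gt0 s0 orbT.
- by rewrite /ncols size_image card_ord.
move=> i j k; rewrite /ncols /nrows /= !size_image !card_ord => hi hj.
rewrite /exponent /weight/= (nth_codom_ord _ _ (Ordinal hi)) (nth_codom_ord _ _ (Ordinal hj)).
apply: laguerre_row_integrable => // rho.
have := hal (Ordinal hi) rho; have := ler0n R k; lra.
Qed.

Lemma jacobi_or_laguerre_integrable S : jacobi_or_laguerre S -> integrable_system S.
Proof.
case=> [p q a b al p0 q0 hab hal|p r s a b be p0 s0 _ _ hab hal].
  exact: jacobi_integrable.
exact: laguerre_integrable.
Qed.

End Weights.

                     

(** * Determinants when a unit lower triangular [c] makes [c M] upper triangular *)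

Section Determinants.
Variable R : comNzRingType.

(** The row order N, ..., N + b - 1, 0, ..., N - 1. *)
Definition rot_index (b N i : nat) : nat := if (i < b)%N then (N + i)%N else (i - b)%N.

(** The only nonzero entry of the first row stands in column N; expanding along that row gives
    (-1)^N and the same matrix for b - 1. *)
Lemma det_rot (b N : nat) :
  \det (\matrix_(i < b + N, j < b + N) (rot_index b N i == j)%:R : 'M[R]_(b + N))
  = (-1) ^+ (b * N).
Proof.
elim: b => [|b IHb].
  rewrite mul0n expr0 -[RHS](det1 R N); congr (\det _); apply/matrixP => i j.
  by rewrite !mxE /rot_index/= subn0.
have hN : (N < b.+1 + N)%N by rewrite addSn ltnS leq_addl.
rewrite (expand_det_row _ ord0) (bigD1 (Ordinal hN))//= big1 ?addr0; last first.
  move=> j jN; rewrite !mxE /rot_index /= addn0.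
  by case: eqP => [E|]; rewrite ?mul0r//; case/eqP: jN; exact: val_inj.
rewrite mxE /rot_index /= addn0 eqxx mul1r /cofactor /= add0n mulSn exprD -IHb.
congr (_ * \det _); apply/matrixP => i j; rewrite !mxE /rot_index /=.
have h : (i < b + N)%N := ltn_ord i.
rewrite /bump /= ltnS add1n subSS addnS; congr ((nat_of_bool _)%:R).
move: (nat_of_ord i) (nat_of_ord j) h => {}i {}j h.
by case: (ltnP i b) => ib; case: (leqP N j) => Nj /=; apply/idP/idP => /eqP E; apply/eqP; lia.
Qed.

(** The determinant of [P C K] is computed twice: as a product of three determinants, and from its
    block lower triangular shape, in which the tau matrix sits in the upper left corner. *)
Lemma shifted_minor_tau (M c : nat -> nat -> R) (b N : nat) :
  (forall m, c m m = 1) -> (forall m k, (m < k)%N -> c m k = 0) ->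
  (forall m n, (n < m)%N -> \sum_(k < m.+1) c m k * M k n = 0) ->
  \det (\matrix_(i < N, j < N) M (b + i)%N j) =
  (-1) ^+ (b * N) * \det (\matrix_(i < b, j < b) c (N + i)%N j)
    * \det (\matrix_(i < N, j < N) M i j).
Proof.
move=> c1 c0 cM.
have detC n : \det (\matrix_(i < n, j < n) c i j) = 1.
  rewrite det_trig; first by apply: big1 => i _; rewrite mxE c1.
  by apply/is_trig_mxP => i j ij; rewrite mxE c0.
have sumC n (i : 'I_n) (j : nat) :
    \sum_(k < n) c i k * M k j = \sum_(k < i.+1) c i k * M k j.
  rewrite [RHS](big_ord_widen n (fun k => c i k * M k j))// [RHS]big_mkcond/=.
  by apply: eq_bigr => k _; case: ltnP => // ik; rewrite c0// mul0r.
(* The first b + N rows of [M], bordered on the left by b unit columns: the determinant is the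
   shifted minor, and the border records the first b columns of [c] after multiplication by [C]. *)
pose K : 'M[R]_(b + N) := block_mx 1%:M (\matrix_(i, j) M i j) 0 (\matrix_(i, j) M (b + i)%N j).
pose C : 'M[R]_(b + N) := \matrix_(i, j) c i j.
pose P : 'M[R]_(b + N) := \matrix_(i, j) (rot_index b N i == j)%:R.
have rot_lt (i : 'I_(b + N)) : (rot_index b N i < b + N)%N.
  rewrite /rot_index; have := ltn_ord i; move: (nat_of_ord i) => {}i h.
  by case: (ltnP i b) => ?; lia.
have PE (A : 'M[R]_(b + N)) i j : (P *m A) i j = A (Ordinal (rot_lt i)) j.
  rewrite mxE (bigD1 (Ordinal (rot_lt i)))//= big1 ?addr0 ?mxE ?eqxx ?mul1r//.
  move=> k ki; rewrite mxE; case: eqP => [E|]; rewrite ?mul0r//.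
  by case/eqP: ki; exact: val_inj.
have CKl (i : 'I_(b + N)) (j : 'I_b) : (C *m K) i (lshift N j) = c i j.
  rewrite mxE (bigD1 (lshift N j))//= big1 ?addr0.
    by rewrite block_mxEul !mxE eqxx mulr1.
  move=> k kj; rewrite /K -[k](splitK k); case: fintype.splitP => k' kk'; rewrite /=.
    rewrite block_mxEul [X in _ * X]mxE; case: eqP => [E|]; rewrite ?mulr0//.
    by case/eqP: kj; apply: val_inj; rewrite /= kk' E.
  by rewrite block_mxEdl [X in _ * X]mxE mulr0.
have CKr (i : 'I_(b + N)) (j : 'I_N) :
    (C *m K) i (rshift b j) = \sum_(k < i.+1) c i k * M k j.
  rewrite -(sumC (b + N)%N) mxE; apply: eq_bigr => k _.
  rewrite /K -[k](splitK k); case: fintype.splitP => k' kk'; rewrite /=.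
    by rewrite block_mxEur !mxE.
  by rewrite block_mxEdr !mxE.
have detK : \det K = \det (\matrix_(i < N, j < N) M (b + i)%N j).
  by rewrite det_ublock det1 mul1r.
have detP : \det P = (-1) ^+ (b * N) by exact: det_rot.
have detQ : \det (P *m (C *m K)) =
    \det (\matrix_(i < b, j < b) c (N + i)%N j) * \det (\matrix_(i < N, j < N) M i j).
  rewrite -[P *m _]submxK.
  (* The rows moved to the top have index at least N, while the columns have index below N:
     orthogonality applies. *)
  have -> : ursubmx (P *m (C *m K)) = 0.
    apply/matrixP => i j; rewrite mxE [LHS]mxE PE CKr [RHS]mxE.
    by apply: cM; rewrite /= /rot_index /= ltn_ord; have := ltn_ord j; lia.
  rewrite det_lblock; congr (_ * _).
    congr (\det _); apply/matrixP => i j; rewrite mxE [LHS]mxE PE CKl [RHS]mxE.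
    by rewrite /= /rot_index /= ltn_ord.
  rewrite -[RHS]mul1r -(detC N) -det_mulmx; congr (\det _).
  apply/matrixP => i j; rewrite mxE [LHS]mxE PE CKr.
  rewrite /= /rot_index/= ltnNge leq_addr /= addKn -(sumC N) mxE.
  by apply: eq_bigr => k _; rewrite !mxE.
rewrite -detK -mulrA -detQ !det_mulmx detC mul1r detP mulrA -exprD addnn -mul2n.
by rewrite exprM sqrrN !expr1n mul1r.
Qed.

(** The product [c M] has the determinant of [M] and is triangular, so only its diagonal counts. *)
Lemma det_pivots (M c : nat -> nat -> R) (N : nat) :
  (forall m, c m m = 1) -> (forall m k, (m < k)%N -> c m k = 0) ->
  (forall m n, (n < m)%N -> \sum_(k < m.+1) c m k * M k n = 0) ->
  \det (\matrix_(i < N, j < N) M i j) =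
  \prod_(m < N) \sum_(k < m.+1) c m k * M k m.
Proof.
move=> c1 c0 cM.
have sumC (i : 'I_N) (j : nat) :
    \sum_(k < N) c i k * M k j = \sum_(k < i.+1) c i k * M k j.
  rewrite [RHS](big_ord_widen N (fun k => c i k * M k j))// [RHS]big_mkcond/=.
  by apply: eq_bigr => k _; case: ltnP => // ik; rewrite c0// mul0r.
have detC : \det (\matrix_(i < N, j < N) c i j) = 1.
  rewrite det_trig; first by apply: big1 => i _; rewrite mxE c1.
  by apply/is_trig_mxP => i j ij; rewrite mxE c0.
transitivity (\det ((\matrix_(i < N, j < N) c i j) *m (\matrix_(i < N, j < N) M i j))).
  by rewrite det_mulmx detC mul1r.
rewrite -det_tr det_trig.
  by apply: eq_bigr => i _; rewrite !mxE -sumC; apply: eq_bigr => k _; rewrite !mxE.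
apply/is_trig_mxP => i j ij; rewrite !mxE.
transitivity (\sum_(k < j.+1) c j k * M k i); last exact: cM.
rewrite -(sumC j).
by apply: eq_bigr => k _; rewrite !mxE.
Qed.

End Determinants.

                                                

(** * Step-line coordinates and pairings of forms *)

Section Forms.
Context {R : realType}.
Notation mu := (@lebesgue_measure R).
Implicit Types (S : mixed_system R) (P : nat -> {poly R}) (B : nat -> nat -> {poly R}).

(** The coordinate along x^u V_j, where m = q u + j numbers the rows of the moment matrix. *)
Definition form_coef q P m : R := (P (m %% q)%N)`_(m %/ q).

Definition form_pairing S P n : R :=
  Rintegral mu (domain S) (fun x =>
    x `^ (exponent S (n %% ncols S)%N + (n %/ ncols S)%:R) * linear_form S P x).

(** Turns the degree bounds and the orthogonality ranges, given component by component, into initial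
    segments of the step-line numbering. *)
Lemma step_lineP d N u j : (j < d)%N ->
  (u < step_line d N j)%N = (d * u + j < N)%N.
Proof.
move=> jd; rewrite /step_line [in RHS](divn_eq N d).
have := ltn_pmod N (leq_ltn_trans (leq0n j) jd).
move: (N %/ d)%N (N %% d)%N => a r rd.
case: (ltngtP u a) => [ua|ua|->].
- have : (u.+1 * d <= a * d)%N by rewrite leq_mul2r ua orbT.
  by case: (ltnP j r) => jr; lia.
- have : (a.+1 * d <= u * d)%N by rewrite leq_mul2r ua orbT.
  by case: (ltnP j r) => jr; lia.
- by case: (ltnP j r) => jr; lia.
Qed.

Lemma form_coef_gt S N P m : (0 < nrows S)%N -> normalized_form S N P ->
  (N < m)%N -> form_coef (nrows S) P m = 0.
Proof.
move=> q0 hP Nm; have jq := ltn_pmod m q0.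
rewrite /form_coef nth_default// (leq_trans (form_degree hP jq))//.
rewrite leqNgt step_lineP// mulnC -divn_eq; lia.
Qed.

Lemma form_coef_diag S N P : (0 < nrows S)%N -> normalized_form S N P ->
  form_coef (nrows S) P N = 1.
Proof.
move=> q0 hP; rewrite /form_coef -[RHS](form_normalized hP) /=.
congr (_`_ _); have jq := ltn_pmod N q0.
have h1 : (N %/ nrows S < step_line (nrows S) N.+1 (N %% nrows S))%N.
  by rewrite step_lineP// mulnC -divn_eq.
have h2 : ~~ ((N %/ nrows S).+1 < step_line (nrows S) N.+1 (N %% nrows S))%N.
  by rewrite step_lineP// mulnS mulnC -addnA -divn_eq; lia.
move: (step_line _ _ _) (N %/ _)%N h1 h2 => s u h1 h2; lia.
Qed.

Lemma sum_divn_modn (V : nmodType) q (F : nat -> nat -> V) n : (0 < q)%N ->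
  \sum_(m < n * q) F (m %% q)%N (m %/ q)%N = \sum_(j < q) \sum_(u < n) F j u.
Proof.
move=> q0; rewrite exchange_big/=; elim: n => [|n IHn]; first by rewrite !big_ord0.
rewrite big_ord_recr/= -IHn mulSn addnC big_split_ord/=; congr (_ + _).
by apply: eq_bigr => j _; rewrite modnMDl divnMDl// modn_small// divn_small// addn0.
Qed.

Section Pairing.
Variables (S : mixed_system R) (iS : integrable_system S).
Let q := nrows S.
Let p := ncols S.

Lemma moment_integrable m n : mu.-integrable (domain S) (fun x =>
  (x `^ ((m %/ q)%:R + (n %/ p)%:R + exponent S (n %% p)) * weight S (m %% q) x)%:E).
Proof.
by have [_ _ q0 p0 H] := iS; rewrite -natrD; apply: H; exact: ltn_pmod.
Qed.

Lemma form_integrandE P N n : (forall m, (N < m)%N -> form_coef q P m = 0) ->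
  {in domain S, (fun x => x `^ (exponent S (n %% p)%N + (n %/ p)%:R) * linear_form S P x)
   =1 fun x => \sum_(m < N.+1) form_coef q P m *
     (x `^ ((m %/ q)%:R + (n %/ p)%:R + exponent S (n %% p)) * weight S (m %% q) x)}.
Proof.
move=> cN x; rewrite inE => Dx; have [_ Dpos q0 _ _] := iS.
have x0 : 0 < x by have := Dpos _ Dx; rewrite /= in_itv/= andbT.
pose F j u := (P j)`_u * (x `^ (u%:R + (n %/ p)%:R + exponent S (n %% p)) * weight S j x).
(* Padding with vanishing coordinates up to N + 1 complete blocks of q rows makes the sum a
   rectangular double sum over components and degrees. *)
rewrite (big_ord_widen (N.+1 * q) (fun m => F (m %% q)%N (m %/ q)%N)) ?leq_pmulr//.
rewrite big_mkcond/= [RHS](_ : _ = \sum_(m < N.+1 * q) F (m %% q)%N (m %/ q)%N); last first.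
  apply: eq_bigr => m _; case: ltnP => // Nm.
  by rewrite /F -[(P _)`_ _]/(form_coef q P m) cN// mul0r.
rewrite sum_divn_modn// /linear_form mulr_sumr; apply: eq_bigr => j _.
have szP : (size (P j) <= N.+1)%N.
  apply/leq_sizeP => u Nu.
  have h : (N < u * q + j)%N.
    exact: (leq_trans Nu (leq_trans (leq_pmulr u q0) (leq_addr j _))).
  have := cN _ h.
  by rewrite /form_coef modnMDl divnMDl// modn_small// divn_small// addn0.
rewrite (horner_coef_wide _ szP) mulr_suml mulr_sumr; apply: eq_bigr => u _.
rewrite /F -powR_mulrn ?(ltW x0)//.
have -> : u%:R + (n %/ p)%:R + exponent S (n %% p) =
    (exponent S (n %% p) + (n %/ p)%:R) + u%:R by ring.
rewrite [in RHS]powRD ?(gt_eqF x0) ?implybT//; ring.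
Qed.

Lemma form_term_integrable P m n : mu.-integrable (domain S) (EFin \o (fun x =>
  form_coef q P m *
    (x `^ ((m %/ q)%:R + (n %/ p)%:R + exponent S (n %% p)) * weight S (m %% q) x))).
Proof.
have [mD _ _ _ _] := iS.
rewrite (_ : _ \o _ = (fun x => (form_coef q P m)%:E * (x `^ ((m %/ q)%:R + (n %/ p)%:R
   + exponent S (n %% p)) * weight S (m %% q) x)%:E)%E) //.
by apply: integrableZl; [exact: mD|exact: moment_integrable].
Qed.

Lemma form_integrable P N n : (forall m, (N < m)%N -> form_coef q P m = 0) ->
  mu.-integrable (domain S) (fun x =>
    (x `^ (exponent S (n %% p)%N + (n %/ p)%:R) * linear_form S P x)%:E).
Proof.
move=> cN; have [mD _ _ _ _] := iS.
have iF : mu.-integrable (domain S) (fun x => \sum_(m < N.+1) (form_coef q P m *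
     (x `^ ((m %/ q)%:R + (n %/ p)%:R + exponent S (n %% p)) * weight S (m %% q) x))%:E)%E.
  by apply: integrable_sum; [exact: mD|move=> m _; exact: form_term_integrable].
apply: (eq_integrable _ _ _ _ iF); first exact: mD.
by move=> x Dx; rewrite (form_integrandE n cN Dx) sumEFin.
Qed.

(** The link between integrals and algebra: the pairings of the forms are the entries of [c M].
    Splitting the integral relies on the integrability of each term. *)
Lemma form_pairingE P N n : (forall m, (N < m)%N -> form_coef q P m = 0) ->
  form_pairing S P n = \sum_(m < N.+1) form_coef q P m * moment S m n.
Proof.
move=> cN; have [mD _ _ _ _] := iS.
transitivity (Rintegral mu (domain S) (fun x => \sum_(m < N.+1) form_coef q P m *
     (x `^ ((m %/ q)%:R + (n %/ p)%:R + exponent S (n %% p)) * weight S (m %% q) x))).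
  by apply: eq_Rintegral => x Dx; exact: form_integrandE Dx.
elim: N.+1 => [|M IH].
  rewrite big_ord0; under eq_Rintegral do rewrite big_ord0.
  by rewrite /Rintegral integral0.
under eq_Rintegral do rewrite big_ord_recr/=.
rewrite big_ord_recr/= RintegralD//; last 2 first.
- rewrite (_ : _ \o _ = (fun x => \sum_(m < M) (form_coef q P m *
     (x `^ ((m %/ q)%:R + (n %/ p)%:R + exponent S (n %% p)) * weight S (m %% q) x))%:E)%E).
    by apply: integrable_sum => // m _; exact: form_term_integrable.
  by apply/funext => x; rewrite /= sumEFin.
- exact: form_term_integrable.
by rewrite IH RintegralZl//; exact: moment_integrable.
Qed.

Lemma form_pairing_lt P N n : normalized_form S N P -> (n < N)%N ->
  form_pairing S P n = 0.
Proof.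
move=> hP nN; have [_ _ _ p0 _] := iS.
apply: (form_orthogonal hP); first exact: ltn_pmod.
by rewrite step_lineP ?ltn_pmod// mulnC -divn_eq.
Qed.

End Pairing.
End Forms.

(** * Tau-determinants, Christoffel transforms and pivots *)

Section Christoffel.
Context {R : realType}.
Notation mu := (@lebesgue_measure R).
Implicit Types (S : mixed_system R) (P : nat -> {poly R}) (B C : nat -> nat -> {poly R}).

Lemma step_line_forms_coef S C (iS : integrable_system S) : step_line_forms S C ->
  let c m k := form_coef (nrows S) (C m) k in
  [/\ forall m, c m m = 1, forall m k, (m < k)%N -> c m k = 0 &
      forall m n, form_pairing S (C m) n = \sum_(k < m.+1) c m k * moment S k n].
Proof.
move=> hC c; have [_ _ q0 _ _] := iS; split.
- by move=> m; exact: form_coef_diag.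
- by move=> m k mk; exact: (form_coef_gt q0 (hC m)).
- move=> m n; apply: form_pairingE => // k mk; exact: (form_coef_gt q0 (hC m)).
Qed.

Lemma shifted_minor0_prod S C N : integrable_system S -> step_line_forms S C ->
  shifted_minor S 0 N = \prod_(m < N) form_pairing S (C m) m.
Proof.
move=> iS hC; have [c1 c0 cE] := step_line_forms_coef iS hC.
rewrite /shifted_minor (det_pivots (c := fun m k => form_coef (nrows S) (C m) k))//.
  by apply: eq_bigr => m _; rewrite cE.
by move=> m n nm; rewrite -cE; exact: form_pairing_lt (hC m) nm.
Qed.

Lemma tauE S B b N : integrable_system S -> step_line_forms S B ->
  (b <= nrows S)%N -> shifted_minor S 0 N != 0 ->
  tau B b N = (-1) ^+ (b * N) * (shifted_minor S b N / shifted_minor S 0 N).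
Proof.
move=> iS hB bq D0; have [c1 c0 cE] := step_line_forms_coef iS hB.
(* For j < b <= q, the constant term of component j is the coefficient of moment row j itself. *)
have -> : tau B b N =
    \det (\matrix_(i < b, j < b) form_coef (nrows S) (B (N + i)%N) j).
  congr (\det _); apply/matrixP => i j; rewrite !mxE horner_coef0 /form_coef.
  have jq : (j < nrows S)%N by rewrite (leq_trans (ltn_ord j)).
  by rewrite modn_small// divn_small.
rewrite {1}/shifted_minor (shifted_minor_tau (c := fun m k => form_coef (nrows S) (B m) k))//.
  rewrite -[X in _ = _ * (_ * X / _)]/(shifted_minor S 0 N) mulfK// mulrA -exprD addnn -mul2n.
  by rewrite exprM sqrrN !expr1n mul1r.
by move=> m n nm; rewrite -cE; exact: form_pairing_lt (hB m) nm.
Qed.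

Lemma nrows_row_christoffel S : nrows (row_christoffel S) = nrows S.
Proof. by rewrite /nrows /row_christoffel/=; case: (weights S) => //= V Vs; rewrite size_rcons. Qed.

Lemma weight_row_christoffel S j : (0 < nrows S)%N -> (j < nrows S)%N ->
  weight (row_christoffel S) j =
  if j.+1 == nrows S then (fun x => x * weight S 0 x) else weight S j.+1.
Proof.
rewrite /nrows /weight /row_christoffel/=; case: (weights S) => //= V Vs _ jq.
by rewrite nth_rcons eqSS; move: jq; rewrite ltnS; case: ltngtP.
Qed.

Lemma integrable_row_christoffel S : integrable_system S ->
  integrable_system (row_christoffel S).
Proof.
move=> [mD Dpos q0 p0 H]; split; rewrite ?nrows_row_christoffel// => i j k ip jq.
rewrite weight_row_christoffel//; case: eqP => jS; last first.
  by apply: H => //; rewrite ltn_neqAle jq andbT; apply/eqP.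
apply: (eq_integrable _ _ _ _ (H i 0%N k.+1 ip q0)); first exact: mD.
move=> x; rewrite inE => /Dpos; rewrite /= in_itv/= andbT => x0; congr (_ %:E).
rewrite -natr1 addrAC [in LHS]powRD ?(gt_eqF x0) ?implybT// powRr1 ?(ltW x0)//.
by rewrite mulrA.
Qed.

(** Rotating the weights moves to the next row within a block; at the end of a block, the extra
    factor x on the first weight supplies the carry to the next power. *)
Lemma moment_row_christoffel S m n : integrable_system S ->
  moment (row_christoffel S) m n = moment S m.+1 n.
Proof.
move=> [mD Dpos q0 p0 H]; rewrite /moment nrows_row_christoffel.
have mq := ltn_pmod m q0.
apply: eq_Rintegral => x; rewrite inE => /Dpos; rewrite /= in_itv/= andbT => x0.
rewrite weight_row_christoffel// /exponent /ncols /=.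
have E := divn_eq m (nrows S).
case: eqP => mS.
  have E2 : m.+1 = ((m %/ nrows S).+1 * nrows S)%N by rewrite mulSn addnC -{3}mS addnS -E.
  rewrite E2 mulnK// modnMl -natr1 -!addrA [1 + _]addrC !addrA.
  rewrite [in RHS]powRD ?(gt_eqF x0) ?implybT// powRr1 ?(ltW x0)//.
  by rewrite -mulrA.
have h : ((m %% nrows S).+1 < nrows S)%N by rewrite ltn_neqAle mq andbT; apply/eqP.
have E2 : m.+1 = (m %/ nrows S * nrows S + (m %% nrows S).+1)%N by rewrite addnS -E.
by rewrite E2 modnMDl divnMDl// (modn_small h) (divn_small h) addn0.
Qed.

Lemma iter_row_christoffel S b : integrable_system S ->
  let S' := iter b row_christoffel S in
  [/\ integrable_system S', nrows S' = nrows S, ncols S' = ncols S,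
      domain S' = domain S & exponents S' = exponents S] /\
  forall m n, moment S' m n = moment S (b + m) n.
Proof.
move=> iS; elim: b => [|b [[i1 i2 i3 i4 i5] i6]] //=; split.
  by split => //; [exact: integrable_row_christoffel|rewrite nrows_row_christoffel].
by move=> m n; rewrite moment_row_christoffel// i6 addnS.
Qed.

Lemma shifted_minor_iter S b N : integrable_system S ->
  shifted_minor (iter b row_christoffel S) 0 N = shifted_minor S b N.
Proof.
move=> iS; congr (\det _); apply/matrixP => i j; rewrite !mxE.
by have [_ ->] := iter_row_christoffel b iS.
Qed.

Lemma infmx_act_upper (U : infmx R) (f : nat -> R -> R) N x :
  upper_bidiagonal1 U -> infmx_act U f N x = U N N * f N x + f N.+1 x.
Proof.
move=> [U1 U0]; rewrite /infmx_act.
rewrite -(fsbig_widen [set` [:: N; N.+1]] setT)//=; last first.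
  move=> k [_ /=]; rewrite !inE => /negP; rewrite negb_or => /andP[h1 h2].
  by rewrite U0 ?mul0r.
rewrite -fsbig_seq/=; last by rewrite inE andbT neq_ltn ltnSn.
by rewrite !big_cons big_nil addr0 U1 mul1r.
Qed.

(** Both systems have the same exponents and domain, so the connection relation may be paired with
    the same column N; form N + 1 is orthogonal to that column. *)
Lemma connects_pivot S S' (U : infmx R) C C' N :
  integrable_system S -> domain S' = domain S -> exponents S' = exponents S ->
  upper_bidiagonal1 U -> step_line_forms S C -> connects U S C S' C' ->
  form_pairing S' (C' N) N = U N N * form_pairing S (C N) N.
Proof.
move=> iS D' e' hU hC cU; have [mD _ q0 _ _] := iS.
have iC M : mu.-integrable (domain S) (EFin \o (fun x =>
    x `^ (exponent S (N %% ncols S)%N + (N %/ ncols S)%:R) * linear_form S (C M) x)).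
  by apply: (@form_integrable _ S iS (C M) M N) => m Mm; exact: (form_coef_gt q0 (hC M)).
have iUC : mu.-integrable (domain S) (EFin \o (fun x => U N N * (
    x `^ (exponent S (N %% ncols S)%N + (N %/ ncols S)%:R) * linear_form S (C N) x))).
  rewrite (_ : _ \o _ = (fun x => (U N N)%:E * (x `^ (exponent S (N %% ncols S)%N
     + (N %/ ncols S)%:R) * linear_form S (C N) x)%:E)%E) //.
  by apply: integrableZl; [exact: mD|exact: iC].
(* The added zero is the pairing of form N + 1 with column N, that is, the superdiagonal term of the
   relation. *)
rewrite -[RHS]addr0 -(form_pairing_lt iS (hC N.+1) (ltnSn N)).
rewrite /form_pairing -RintegralZl// -RintegralD//.
rewrite D' /exponent /ncols e'; apply: eq_Rintegral => x; rewrite inE => Dx.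
by rewrite -(cU N x Dx) infmx_act_upper//; ring.
Qed.

(** Each leading minor is a product of pairings h_m, so consecutive minors have quotient h_N; the
    formula is the ratio of these quotients before and after one transform. *)
Lemma upper_pivotE S (U : nat -> infmx R) (C : nat -> nat -> nat -> {poly R}) b N :
  integrable_system S -> (b < nrows S)%N ->
  (forall b N, (b <= nrows S)%N -> shifted_minor S b N != 0) ->
  upper_bidiagonal1 (U b.+1) ->
  (forall b, (b <= nrows S)%N ->
     step_line_forms (iter b row_christoffel S) (C b)) ->
  connects (U b.+1) (iter b row_christoffel S) (C b)
                    (iter b.+1 row_christoffel S) (C b.+1) ->
  U b.+1 N N = shifted_minor S b N * shifted_minor S b.+1 N.+1
               / (shifted_minor S b N.+1 * shifted_minor S b.+1 N).
Proof.
move=> iS bq D0 hU hC cU.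
have [[i1 _ _ d1 e1] _] := iter_row_christoffel b iS.
have [[i2 _ _ d2 e2] _] := iter_row_christoffel b.+1 iS.
have hC1 := hC _ (ltnW bq); have hC2 := hC _ bq.
have D1 n : shifted_minor S b n.+1
    = shifted_minor S b n * form_pairing (iter b row_christoffel S) (C b n) n.
  by rewrite -!(shifted_minor_iter _ _ iS) !(shifted_minor0_prod _ i1 hC1) big_ord_recr.
have D2 n : shifted_minor S b.+1 n.+1
    = shifted_minor S b.+1 n * form_pairing (iter b.+1 row_christoffel S) (C b.+1 n) n.
  by rewrite -!(shifted_minor_iter _ _ iS) !(shifted_minor0_prod _ i2 hC2) big_ord_recr.
have P := connects_pivot N i1 (etrans d2 (esym d1)) (etrans e2 (esym e1)) hU hC1 cU.
have n1 := D0 b N (ltnW bq); have n2 := D0 b.+1 N bq; have n3 := D0 b N.+1 (ltnW bq).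
(* The minor of size N + 1 being nonzero forces the old pairing h_N, by which one divides, to be
   nonzero. *)
move: n3; rewrite D2 D1 P mulf_eq0 negb_or => /andP[_ n3].
by field; rewrite n1 n2 n3.
Qed.

End Christoffel.

Theorem proposition7p6 (R : realType) (S : mixed_system R)
    (hS : jacobi_or_laguerre S)
    (hminors : forall b N : nat, (b <= nrows S)%N -> shifted_minor S b N != 0)
    (B : nat -> nat -> {poly R}) (hB : step_line_forms S B) :
  (forall b N : nat, (b <= nrows S)%N ->
     tau B b N
     = (-1) ^+ (b * N) * (shifted_minor S b N / shifted_minor S 0 N)) /\
  (forall (T : infmx R) (L U : nat -> infmx R),
     recurrence_matrix S B T -> christoffel_gauss_borel S T L U ->
     forall b N : nat, (1 <= b <= nrows S)%N ->
       U b N N = shifted_minor S b.-1 N * shifted_minor S b N.+1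
                 / (shifted_minor S b.-1 N.+1 * shifted_minor S b N)).
Proof.
have iS := jacobi_or_laguerre_integrable hS; split.
  by move=> b N bq; apply: tauE => //; exact: hminors.
move=> T L U _ [_ hU [C [hC cU]] _ _] [//|b] N /= bq.
by apply: upper_pivotE (hU b.+1 _) hC (cU b bq).
Qed.
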